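(* Let $\mathcal{F}_2=\{\mathrm{A}_{k\times l},\mathrm{S}_{k\times l} : k,l\geq 2,\ kl>4\}$. Then $\mathcal{F}_2$ is $11$-ravenous, i.e. $\mathcal{G}(G)\leq 11\,b(G)$ for all $G\in\mathcal{F}_2$.
   Context: For integers $k,l\ge 2$, let $\Pi_{k,l}$ be the set of partitions of $[kl]=\{1,\dots,kl\}$ into exactly $k$ parts each of size $l$. $\mathrm{S}_{k\times l}$ and $\mathrm{A}_{k\times l}$ denote $\mathrm{S}_{kl}$ and $\mathrm{A}_{kl}$ in their natural actions on $\Pi_{k,l}$. For a finite permutation group $G$ on $\Omega$, a base is a subset of $\Omega$ with trivial pointwise stabiliser, and $b(G)$ is the minimum base size. The greedy algorithm builds $\beta_1,\beta_2,\dots$ where each $\beta_i$ lies in a largest orbit of the pointwise stabiliser of $\{\beta_1,\dots,\beta_{i-1}\}$, stopping when this stabiliser is trivial; $\mathcal{G}(G)$ is the maximum size of a base produced this way. A family is $c$-ravenous if $\mathcal{G}(G)\le c\,b(G)$ for every member $G$. *)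

(* Defs.v *)
From mathcomp Require Import all_boot all_fingroup all_solvable.
Set Implicit Arguments.
Unset Strict Implicit.
Unset Printing Implicit Defensive.


Section Generic.
Variables (T : finType) (gT : finGroupType) (act : T -> gT -> T).

Definition pstab (G : {set gT}) (S : {set T}) : {set gT} :=
  [set g in G | [forall x in S, act x g == x]].

Definition orb (H : {set gT}) (x : T) : {set T} := [set act x h | h in H].

Definition is_base (G : {set gT}) (Omega B : {set T}) : bool :=
  (B \subset Omega) && (pstab G B \subset [1 gT]%g).

(* minimum base size b(G) (Omega itself is a base whenever the action is
   faithful, so the default value #|Omega| is never used then) *)
Definition base_size (G : {set gT}) (Omega : {set T}) : nat :=
  \big[minn/#|Omega|]_(B : {set T} | is_base G Omega B) #|B|.

(* s = [beta_1; ...; beta_m] is a run of the greedy algorithm: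
   each beta_i is chosen (while the stabiliser of the previous points is
   nontrivial) in a largest orbit on Omega of the pointwise stabiliser of
   beta_1..beta_{i-1}, and the algorithm stops when the stabiliser is trivial. *)
Definition greedy_base (G : {set gT}) (Omega : {set T}) (s : seq T) : Prop :=
  (forall (p q : seq T) (x : T), s = p ++ x :: q ->
     let H := pstab G [set y in p] in
     [/\ ~~ (H \subset [1 gT]%g), x \in Omega &
         forall y, y \in Omega -> #|orb H y| <= #|orb H x| ])
  /\ pstab G [set y in s] \subset [1 gT]%g.
End Generic.

Definition Pi (k l : nat) : {set {set {set 'I_(k * l)}}} :=
  [set P : {set {set 'I_(k * l)}} |
     [&& partition P [set: 'I_(k * l)], #|P| == k & [forall B in P, #|B| == l]]].

Definition pact (n : nat) (P : {set {set 'I_n}}) (g : {perm 'I_n})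
  : {set {set 'I_n}} := [set [set g x | x in B] | B : {set 'I_n} in P].

(* Main.v *)
(** Put n = kl and let tau be least with n <= k^tau.  The partitions of a base
separate all points (all but one pair, for the alternating group), so a base has
at least tau elements, and it is enough to bound a greedy run by 11 tau.

A partition is represented by a colouring of the points with k colours, its
blocks being the colour classes.  Let H_i be the stabiliser of the first i
greedy partitions and K_i its subgroup fixing every block of each of them; K_i
consists of the (even) permutations that preserve each atom, that is each class
of the common refinement.  All that is used about the greedy choice is
|H_(i+1)| <= |H_i :&: Stab P| for every partition P, so the orders of the H_i
are controlled by exhibiting good partitions P.

Dealing the points of each atom cyclically into the k blocks gives a P that
splits all atoms as evenly as possible.  The potential
[H_i : K_i] * prod_(atoms A) prod_(t < #|A|) (1 + t / kap) compares the greedy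
choice with this P: log-convexity in #|A| shows that whatever the greedy choice
loses on the atoms it gains on the index [H_i : K_i], so the losses telescope
instead of accumulating.  With kap multiplied by k at each step, 2 tau steps
bring |H_i| down to a bound independent of l.

From then on random partitions take over.  A random partition is fixed by a
given h <> 1 with probability about 1/k, and by a given h in H_i outside K_i,
which moves a whole block off itself, with probability about k^(-l).  The first
estimate divides |H_i| by about k at each step and settles k <= 11.  If
l <= k - 2, dealing gives a rigid bipartite incidence graph and |H_2| <= k^2.
In the remaining cases the second estimate and the even splitting of the atoms
together reduce log |H_i| geometrically, until the nontrivial atoms cover fewer
than half a block; a partition that splits those atoms and is random elsewhere
then leaves only the permutations inside the pieces of the atoms. *)

Require Import Defs.
From mathcomp Require Import all_boot all_fingroup all_solvable.
From mathcomp Require Import zify.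

Set Implicit Arguments.
Unset Strict Implicit.
Unset Printing Implicit Defensive.

(** * Ranking the points of a finite set by an injective key *)

Section Rank.
Variables (T : finType) (A : {set T}) (key : T -> nat).
Hypothesis key_inj : {in A &, injective key}.

Definition rank (x : T) := #|[set y in A | key y < key x]|.

Lemma rank_lt x : x \in A -> rank x < #|A|.
Proof.
move=> xA; apply: proper_card; apply/properP; split.
  by apply/subsetP=> y; rewrite inE => /andP[].
by exists x => //; rewrite inE ltnn andbF.
Qed.

Lemma rank_mono x y : x \in A -> key x < key y -> rank x < rank y.
Proof.
move=> xA lt; apply: proper_card; apply/properP; split.
  apply/subsetP=> z; rewrite !inE => /andP[-> /= h]; exact: ltn_trans h lt.
by exists x; rewrite !inE ?xA // ltnn andbF.
Qed.

Lemma rank_inj : {in A &, injective rank}.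
Proof.
move=> x y xA yA e; apply: key_inj => //.
case: (ltngtP (key x) (key y)) => // h.
  by have := rank_mono xA h; rewrite e ltnn.
by have := rank_mono yA h; rewrite e ltnn.
Qed.

Lemma perm_rank : perm_eq [seq rank x | x <- enum A] (iota 0 #|A|).
Proof.
apply: uniq_perm; rewrite ?iota_uniq //.
  rewrite map_inj_in_uniq ?enum_uniq // => x y; rewrite !mem_enum; exact: rank_inj.
apply: (uniq_min_size _ _ _).2.
- rewrite map_inj_in_uniq ?enum_uniq // => x y; rewrite !mem_enum; exact: rank_inj.
- move=> _ /mapP[x xA ->]; rewrite mem_enum in xA.
  by rewrite mem_iota /= rank_lt.
- by rewrite size_iota size_map -cardE.
Qed.

Lemma prod_rank (F : nat -> nat) :
  \prod_(x in A) F (rank x) = \prod_(t < #|A|) F t.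
Proof.
rewrite -big_enum -(big_map rank xpredT F) (perm_big _ perm_rank) /=.
by rewrite -[in RHS](big_mkord xpredT F) /index_iota subn0.
Qed.

Lemma card_rank (P : pred nat) :
  #|[set x in A | P (rank x)]| = \sum_(t < #|A|) P t.
Proof.
rewrite -sum1_card (eq_bigl (fun x => (x \in A) && P (rank x))); last by move=> x; rewrite inE.
rewrite big_mkcondr /= (eq_bigr (fun x => nat_of_bool (P (rank x)))); last by move=> x _; case: (P _).
rewrite -big_enum -(big_map rank xpredT (fun t => nat_of_bool (P t))).
rewrite (perm_big _ perm_rank) /=.
by rewrite -[in RHS](big_mkord xpredT (fun t => nat_of_bool (P t))) /index_iota subn0.
Qed.
End Rank.

(** * Fibres of a map and their stabilisers *)

Section Groups.
Variable n : nat.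
Implicit Types g h : {perm 'I_n}.

(* [fixg f] is the stabiliser of the partition of ['I_n] into the fibres of [f],
   [kerg f] the subgroup fixing each fibre. *)
Definition kerg (F : eqType) (f : 'I_n -> F) : {set {perm 'I_n}} :=
  [set g : {perm 'I_n} | [forall x, f (g x) == f x]].

Definition fixg (F : eqType) (f : 'I_n -> F) : {set {perm 'I_n}} :=
  [set g : {perm 'I_n} | [forall x, forall y, (f (g x) == f (g y)) == (f x == f y)]].

Lemma kergP (F : eqType) (f : 'I_n -> F) g :
  reflect (forall x, f (g x) = f x) (g \in kerg f).
Proof. by rewrite inE; apply: (iffP forallP) => h x; apply/eqP. Qed.

Lemma fixgP (F : eqType) (f : 'I_n -> F) g :
  reflect (forall x y, (f (g x) == f (g y)) = (f x == f y)) (g \in fixg f).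
Proof.
rewrite inE; apply: (iffP forallP) => h x; last by apply/forallP=> y; rewrite h.
by move=> y; have /forallP/(_ y)/eqP := h x.
Qed.

Lemma kerg_group_set (F : eqType) (f : 'I_n -> F) : group_set (kerg f).
Proof.
apply/group_setP; split; first by apply/kergP=> x; rewrite perm1.
by move=> g h /kergP gP /kergP hP; apply/kergP=> x; rewrite permM hP gP.
Qed.
Canonical kerg_group (F : eqType) (f : 'I_n -> F) := Group (kerg_group_set f).

Lemma fixg_group_set (F : eqType) (f : 'I_n -> F) : group_set (fixg f).
Proof.
apply/group_setP; split; first by apply/fixgP=> x y; rewrite !perm1.
by move=> g h /fixgP gP /fixgP hP; apply/fixgP=> x y; rewrite !permM hP gP.
Qed.
Canonical fixg_group (F : eqType) (f : 'I_n -> F) := Group (fixg_group_set f).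

Lemma kerg_sub_fixg (F : eqType) (f : 'I_n -> F) : kerg f \subset fixg f.
Proof. by apply/subsetP=> g /kergP h; apply/fixgP=> x y; rewrite !h. Qed.

Definition fib (F : finType) (f : 'I_n -> F) z := [set x | f x == z].

Lemma sum_fib (F : finType) (f : 'I_n -> F) : \sum_z #|fib f z| = n.
Proof.
rewrite -[RHS]card_ord -sum1_card (partition_big f xpredT) //=.
by apply: eq_bigr => z _; rewrite -sum1_card; apply: eq_bigl => x; rewrite inE.
Qed.

(** Stabiliser chain: [K j] fixes all points from [j] on. An element of [K j.+1] sends [j] to one of
    the [(t j).+1] points [y <= j] of its fibre, and a transposition carries [K j] onto each of
    these classes. *)
Lemma card_kerg (F : finType) (f : 'I_n -> F) :
  #|kerg f| = \prod_z #|fib f z|`!.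
Proof.
pose K j := [set g : {perm 'I_n} in kerg f | [forall x : 'I_n, (j <= x) ==> (g x == x)]].
pose t (x : 'I_n) := rank (fib f (f x)) (@nat_of_ord n) x.
have KP j g : reflect ((forall x, f (g x) = f x) /\ forall x : 'I_n, j <= x -> g x = x) (g \in K j).
  rewrite 2!inE; apply: (iffP andP) => [[/forallP h1 /forallP h2]|[h1 h2]]; split.
  - by move=> x; apply/eqP.
  - by move=> x jx; have := h2 x; rewrite jx /= => /eqP.
  - by apply/forallP=> x; rewrite h1.
  - by apply/forallP=> x; apply/implyP=> /h2 ->.
have step (j : 'I_n) : #|K j.+1| = #|K j| * (t j).+1.
  pose Y := [set y : 'I_n | (f y == f j) && (y <= j)].
  have cY : #|Y| = (t j).+1.
    rewrite (cardsD1 j) inE eqxx leqnn add1n; congr _.+1.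
    apply: eq_card => y; rewrite !inE ltn_neqAle andbCA (inj_eq val_inj).
    by [].
  rewrite -sum1_card (partition_big (fun g : {perm 'I_n} => g j) (mem Y)) /=.
    transitivity (\sum_(y in Y) #|K j|); last by rewrite sum_nat_const cY mulnC.
    apply: eq_bigr => y.
    rewrite inE => /andP[/eqP fy yj].
    rewrite -sum1_card (reindex_inj (mulIg (tperm j y))) /=.
    apply: eq_bigl => g; apply/andP/idP.
      case=> /KP[h1 h2] /eqP gj; apply/KP; rewrite permM in gj.
      have e : g j = j by apply: (@perm_inj _ (tperm j y)); rewrite gj tpermL.
      split=> x.
        rewrite -[RHS]h1 permM.
        by case: tpermP => // ->.
      rewrite leq_eqVlt => /orP[/eqP/val_inj <- //|jx].
      have := h2 x jx; rewrite permM => e2.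
      apply: (@perm_inj _ (tperm j y)); rewrite e2 tpermD //.
        by apply: contraTneq jx => <-; rewrite ltnn.
      by apply: contraTneq jx => <-; rewrite -leqNgt.
    case/KP => h1 h2; rewrite permM h2 // tpermL eqxx; split => //.
    apply/KP; split=> x.
      by rewrite permM -[RHS]h1; case: tpermP => // ->.
    move=> jx; rewrite permM h2 1?ltnW // tpermD //.
      by apply: contraTneq jx => <-; rewrite ltnn.
    by apply: contraTneq jx => <-; rewrite -leqNgt.
  move=> g /KP[h1 h2]; rewrite inE h1 eqxx /= leqNgt; apply/negP=> lt.
  have := h2 _ lt => /perm_inj e; by rewrite e ltnn in lt.
have cK j : j <= n -> #|K j| = \prod_(x < n | x < j) (t x).+1.
  elim: j => [_|j IH jn].
    rewrite big1 // -(cards1 (1%g : {perm 'I_n})).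
    apply: eq_card => g; rewrite inE; apply/KP/eqP => [[_ h]|->].
      by apply/permP=> x; rewrite h // perm1.
    by split=> x; rewrite perm1.
  rewrite (step (Ordinal jn)) IH 1?ltnW // [RHS](bigD1 (Ordinal jn)) //= mulnC.
  congr (_ * _); apply: eq_bigl => x.
  by rewrite ltnS -(inj_eq val_inj) /= [RHS]andbC ltn_neqAle.
have -> : kerg f = K n.
  apply/setP=> g; rewrite inE [in RHS]inE; apply/idP/idP => [h|/andP[]//].
    by rewrite inE h; apply/forallP=> x; rewrite leqNgt ltn_ord.
  by rewrite inE.
rewrite cK // (partition_big f xpredT) //=; apply: eq_bigr => z _.
rewrite (eq_bigl (mem (fib f z))) => [|x]; last by rewrite /= ltn_ord inE.
rewrite (eq_bigr (fun x => (rank (fib f z) (@nat_of_ord n) x).+1)).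
  rewrite (prod_rank _ (fun t => t.+1)); last by move=> x y _ _ /val_inj.
  by rewrite fact_prod big_add1 big_mkord.
by move=> x /=; rewrite [in X in X -> _]inE /t => /eqP ->.
Qed.

End Groups.

(** * Weights of fibre partitions *)

(** [rise] is the rising factorial. [brise k kap a] is the product of [rise kap] over [k] pieces
    when [a] points are split evenly: in cyclic dealing point [t] joins a piece that already has
    [t %/ k] points. *)
Definition rise (kap a : nat) := \prod_(t < a) (kap + t).
Definition brise (k kap a : nat) := \prod_(t < a) (kap + t %/ k).

Lemma rise1 a : rise 1 a = a`!.
Proof. by rewrite fact_prod big_add1 big_mkord. Qed.

Lemma brise_gt0 k kap a : 0 < kap -> 0 < brise k kap a.
Proof. by move=> h; rewrite prodn_gt0 // => i; rewrite ltn_addr. Qed.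

Lemma brise_rise k kap a : k ^ a * brise k kap a <= rise (k * kap) a.
Proof.
elim: a => [|a IH]; first by rewrite /brise /rise !big_ord0.
rewrite /brise /rise !big_ord_recr /= expnSr -/(brise k kap a) -/(rise (k * kap) a).
rewrite mulnACA; apply: leq_mul => //.
by rewrite mulnDr leq_add2l mulnC leq_trunc_div.
Qed.

(** Factor by factor: with q = t %/ k <= k - 2 one has (1 + q)^2 <= 1 + k q <= 1 + t. *)
Lemma brise_sq k a : a <= k * k.-1 -> brise k 1 a ^ 2 <= a`!.
Proof.
rewrite -rise1; elim: a => [_|a IH le]; first by rewrite /brise /rise !big_ord0.
rewrite /brise /rise !big_ord_recr /= expnMn; apply: leq_mul; first exact: (IH (ltnW le)).
have k0 : 0 < k by case: k le {IH}.
have h := divn_eq a k; have h1 : a %/ k < k.-1 by rewrite ltn_divLR // mulnC.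
move: h h1; set q := a %/ k; set r := a %% k; nia.
Qed.

Lemma brise_small k a : a <= k -> brise k 1 a = 1.
Proof.
by move=> h; rewrite /brise big1 // => i _; rewrite divn_small // (leq_trans (ltn_ord i)).
Qed.

(* The ratio [(kap + t) / (1 + t)] decreases in [t], so the product over the
   pieces is largest when the pieces have equal sizes; remove a point from a
   largest piece. *)
Lemma rise_conv k kap (a : 'I_k -> nat) : 0 < kap ->
  (\prod_p rise kap (a p)) * brise k 1 (\sum_p a p) <=
  brise k kap (\sum_p a p) * \prod_p rise 1 (a p).
Proof.
move=> kap0; move e : (\sum_p a p) => s; elim: s a e => [|s IH] a e.
  by rewrite /brise !big_ord0 muln1 mul1n !big1 // => p _;
    move/eqP: e; rewrite sum_nat_eq0 => /forallP/(_ p)/eqP ->; rewrite /rise big_ord0.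
have [p0 p0max] : exists p0, forall p, a p <= a p0.
  case: k a e {IH} => [|k] a e; first by move: e; rewrite big_ord0.
  case: (@arg_maxnP _ ord0 xpredT a erefl) => p0 _ h; exists p0 => p; exact: h.
have kge : s < k * a p0.
  rewrite -e -[k in k * _]card_ord -sum_nat_const; exact: leq_sum.
have k0 : 0 < k by rewrite (leq_ltn_trans (leq0n p0)).
have ap0 : 0 < a p0 by case: (a p0) kge; rewrite ?muln0.
pose a' p := if p == p0 then (a p0).-1 else a p.
have e' : \sum_p a' p = s.
  move: e; rewrite (bigD1 p0) //= [X in _ -> X = _](bigD1 p0) //= /a' eqxx.
  rewrite [in X in _ -> X = _](eq_bigr (fun i => a i)); last by move=> i /negbTE ->.
  by lia.
have pr K : \prod_p rise K (a p) = (\prod_p rise K (a' p)) * (K + (a p0).-1).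
  rewrite (bigD1 p0) //= [in RHS](bigD1 p0) //= /a' eqxx.
  rewrite [in RHS](eq_bigr (fun i => rise K (a i))); last by move=> i /negbTE ->.
  rewrite -[in LHS](prednK ap0) {1}/rise big_ord_recr /= -/(rise _ _).
  by rewrite -!mulnA; congr (_ * _); rewrite mulnC.
have {IH} IH := IH a' e'; rewrite !pr /brise !big_ord_recr /= -!/(brise _ _ _).
set A := \prod_p _ in IH *; set B := \prod_p rise 1 _ in IH *.
have q : s %/ k <= (a p0).-1 by rewrite -ltnS (prednK ap0) ltn_divLR // mulnC.
rewrite mulnACA [X in _ <= X]mulnACA; apply: leq_mul => //.
move: q; set u := s %/ k; set v := (a p0).-1; nia.
Qed.

(** Weierstrass' inequality: prod (1 + t / kap) times (1 - S / kap) is at most 1, S being the sum of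
    the t. The offset [u] lets the fibres be chained one after another in [W_le2]. *)
Lemma rise_weierstrass kap u a :
  rise kap a * (kap - (u + \sum_(t < a) t)) <= kap ^ a * (kap - u).
Proof.
elim: a u => [|a IH] u; first by rewrite /rise !big_ord0 addn0.
rewrite /rise !big_ord_recr /= -/(rise kap a) expnSr.
have := IH u; set S := \sum_(i < a) i; set X := rise _ _; set Y := kap ^ a => h.
have h2 : (kap + a) * (kap - (u + (S + a))) <= kap * (kap - (u + S)) by nia.
rewrite -mulnA; apply: (leq_trans (n := X * (kap * (kap - (u + S))))).
  by rewrite leq_mul2l h2 orbT.
by rewrite mulnCA mulnAC [X in _ <= X]mulnC leq_mul2l h orbT.
Qed.

Section Weights.
Variables (n k : nat).

(** Divided by [kap ^ n], [W kap f] is the product over the atoms in the potential. [bal] is the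
    value that [W] takes when every fibre of [f] is split evenly. *)
Definition W (kap : nat) (F : finType) (f : 'I_n -> F) := \prod_z rise kap #|fib f z|.
Definition bal (kap : nat) (F : finType) (f : 'I_n -> F) := \prod_z brise k kap #|fib f z|.
Definition pairf (F : finType) (f : 'I_n -> F) (c : 'I_n -> 'I_k) x := (f x, c x).

Lemma W1 (F : finType) (f : 'I_n -> F) : W 1 f = #|kerg f|.
Proof. by rewrite card_kerg; apply: eq_bigr => z _; rewrite rise1. Qed.

Variables (F : finType) (f : 'I_n -> F).

Lemma bal_gt0 kap : 0 < kap -> 0 < bal kap f.
Proof. by move=> h; rewrite prodn_gt0 // => z; apply: brise_gt0. Qed.

Lemma fib_pair c z : \sum_p #|fib (pairf f c) (z, p)| = #|fib f z|.
Proof.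
rewrite -[RHS]sum1_card (partition_big c xpredT) //=; apply: eq_bigr => p _.
by rewrite -sum1_card; apply: eq_bigl => x; rewrite !inE.
Qed.

Lemma W_pair kap c : W kap (pairf f c) = \prod_z \prod_p rise kap #|fib (pairf f c) (z, p)|.
Proof. by rewrite pair_big /=; apply: eq_bigr => -[]. Qed.

Lemma W_conv kap c : 0 < kap -> W kap (pairf f c) * bal 1 f <= bal kap f * W 1 (pairf f c).
Proof.
move=> h; rewrite !W_pair /bal -!big_split /=; apply: leq_prod => z _.
by rewrite -(fib_pair c z); apply: rise_conv.
Qed.

Lemma bal_W kap : k ^ n * bal kap f <= W (k * kap) f.
Proof.
rewrite -{1}(sum_fib f) expn_sum /bal -big_split /=; apply: leq_prod => z _.
exact: brise_rise.
Qed.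

(** One telescoping step: [r] stands for the index of the new kernel, [rho] for the loss against an
    even splitting at [kap = 1]. [W_conv] carries this loss to any [kap], and [bal_W] passes to
    [k * kap]. *)
Lemma W_step kap c r rho : 0 < kap ->
  r * #|kerg (pairf f c)| <= rho * bal 1 f ->
  k ^ n * (r * W kap (pairf f c)) <= rho * W (k * kap) f.
Proof.
move=> kap0; rewrite -W1 => h.
apply: leq_trans (_ : rho * (k ^ n * bal kap f) <= _); last by rewrite leq_mul2l bal_W orbT.
rewrite [X in _ <= X]mulnCA leq_mul2l; apply/orP; right.
rewrite -(leq_pmul2r (bal_gt0 (ltn0Sn 0))) -mulnA.
apply: (leq_trans (n := r * (bal kap f * W 1 (pairf f c)))).
  by rewrite leq_mul2l W_conv ?orbT.
by rewrite mulnCA [rho * _]mulnC -mulnA leq_mul2l h orbT.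
Qed.

(** The doubled sum counts the ordered pairs of distinct points in a common fibre; if it is at most
    [kap], the factor 1 - S / kap of Weierstrass' inequality is at least 1/2. *)
Lemma W_le2 kap : 0 < kap -> 2 * (\sum_z \sum_(t < #|fib f z|) t) <= kap ->
  W kap f <= 2 * kap ^ n.
Proof.
move=> kap0 hS.
have gen s u : (\prod_(z <- s) rise kap #|fib f z|) * (kap - (u + \sum_(z <- s) \sum_(t < #|fib f z|) t))
    <= kap ^ (\sum_(z <- s) #|fib f z|) * (kap - u).
  elim: s u => [|z s IH] u; first by rewrite !big_nil addn0.
  rewrite !big_cons expnD addnA -mulnA.
  apply: leq_trans (_ : rise kap #|fib f z| * (kap ^ (\sum_(j <- s) #|fib f j|) * (kap - (u + \sum_(t < #|fib f z|) t))) <= _).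
    by rewrite leq_mul2l IH orbT.
  rewrite mulnCA [X in _ <= X]mulnAC [X in _ <= X]mulnC leq_mul2l.
  by rewrite rise_weierstrass orbT.
have := gen (index_enum F) 0; rewrite sum_fib add0n subn0 -/(W kap f).
set S := \sum_(z <- _) _ in hS * => h.
rewrite -(leq_pmul2r kap0).
apply: leq_trans (_ : 2 * (W kap f * (kap - S)) <= _); last by rewrite -mulnA leq_mul2l h orbT.
by rewrite mulnCA leq_mul2l; apply/orP; right; lia.
Qed.
End Weights.

(** * Dealing colours cyclically *)

Section ModCount.
Variable k : nat.
Hypothesis k0 : 0 < k.

Definition cmod (m : nat) : 'I_k := Ordinal (ltn_pmod m k0).

Lemma cmod_eq a b : (cmod a == cmod b) = (a == b %[mod k]).
Proof. by []. Qed.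

Lemma sum_modk u v : \sum_(j < k) (j + u == v %[mod k]) = 1.
Proof.
pose h (j : 'I_k) := cmod (j + u).
have hinj : injective h.
  move=> i j /(congr1 val) /= /eqP; rewrite eqn_modDr !modn_small // => /eqP; exact: val_inj.
rewrite (eq_bigr (fun j : 'I_k => nat_of_bool (h j == cmod v))); last by move=> j _.
rewrite -(reindex_inj hinj (P := xpredT) (F := fun j => nat_of_bool (j == cmod v))) /=.
rewrite (bigD1 (cmod v)) //= eqxx big1 ?addn0 // => i /negbTE ->.
by [].
Qed.

Lemma sum_mod_self t : \sum_(s < t) (s == t %[mod k]) = t %/ k.
Proof.
have [m] := ubnP t; elim: m t => // m IH t; rewrite ltnS => le.
case: (ltnP t k) => h.
  rewrite divn_small // big1 // => s _.
  by rewrite (modn_small h) modn_small ?(ltn_trans (ltn_ord s) h) // ltn_eqF.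
rewrite -(subnKC h) divnDl // divnn k0 big_split_ord /= /=.
rewrite (eq_bigr (fun j : 'I_k => nat_of_bool (j + 0 == k + (t - k) %[mod k]))); last by move=> j _; rewrite addn0.
rewrite sum_modk; congr (_ + _).
rewrite -IH; last by lia.
by apply: eq_bigr => i _; rewrite eqn_modDl.
Qed.

(** Full periods contribute one to every residue; the at most [k] integers that remain hit [v] at
    most once, while the right side counts its starting point. *)
Lemma sum_mod_le u v a :
  \sum_(j < a) (j + u == v %[mod k]) <= \sum_(j < a) (j == 0 %[mod k]).
Proof.
have [m] := ubnP a; elim: m a u => // m IH a u; rewrite ltnS => le.
case: (leqP a k) => h.
  case: a h le => [|a] h le; first by rewrite !big_ord0.
  apply: (leq_trans (n := 1)); last by rewrite big_ord_recl /= eqxx.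
  rewrite -(sum_modk u v) (big_ord_widen k (fun j => nat_of_bool (j + u == v %[mod k])) h).
  by rewrite big_mkcond /=; apply: leq_sum => i _; case: ifP.
rewrite -(subnKC (ltnW h)) !big_split_ord /=; apply: leq_add.
  rewrite sum_modk (eq_bigr (fun j : 'I_k => nat_of_bool (j + 0 == 0 %[mod k]))) ?sum_modk //.
  by move=> j _; rewrite addn0.
rewrite (eq_bigr (fun j : 'I_(a - k) => nat_of_bool (j + u == v %[mod k]))); last first.
  by move=> j _; rewrite -addnA modnDl.
rewrite [X in _ <= X](eq_bigr (fun j : 'I_(a - k) => nat_of_bool (j == 0 %[mod k]))); last first.
  by move=> j _; rewrite modnDl.
by apply: IH; lia.
Qed.

(** Add the points one at a time: a colour already used m times has its factorial multiplied by m +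
    1. *)
Lemma prod_fact_count (g : nat -> 'I_k) a :
  \prod_p (\sum_(t < a) (g t == p))`! = \prod_(t < a) (\sum_(s < t) (g s == g t)).+1.
Proof.
elim: a => [|a IH].
  by rewrite big_ord0 big1 // => p _; rewrite big_ord0.
rewrite big_ord_recr /= -IH (bigD1 (g a)) //= [in RHS](bigD1 (g a)) //=.
rewrite big_ord_recr /= eqxx addn1 factS -mulnA [RHS]mulnC; congr (_ * (_ * _)); apply: eq_bigr => p /negbTE h.
by rewrite big_ord_recr /= eq_sym h addn0.
Qed.

Lemma prod_plain u a :
  \prod_(t < a) (\sum_(s < t) (u + s == u + t %[mod k])).+1 = brise k 1 a.
Proof.
apply: eq_bigr => t _; rewrite add1n; congr _.+1.
by rewrite -sum_mod_self; apply: eq_bigr => s _; rewrite eqn_modDl.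
Qed.

(* Position [j] of row [i] receives colour [i + del j].  With [del2] colour [i + 1]
   is strictly the most frequent one in row [i], so no permutation preserving the
   rows can exchange colours; with [del3] colours [i] and [i + 1] are strictly the
   most and the second most frequent ones, so only cyclic shifts survive. *)
Definition del2 j := if j is 0 then 1 else j.
Definition del3 j := if j is j'.+3 then j' else (j == 2 : nat).

(** [del2] recolours position 0 of plain dealing from 0 to 1, which multiplies the product by (F1 +
    1) / F0, where [F0] and [F1] count the residues 0 and 1 and [F1 <= F0]. *)
Lemma prod_del2 a : 1 < k ->
  \prod_(t < a) (\sum_(s < t) (del2 s == del2 t %[mod k])).+1 <= 2 * brise k 1 a.
Proof.
move=> k1.
case: a => [|a]; first by rewrite /brise !big_ord0.
set P := fun a => \prod_(t < a) (\sum_(s < t) (del2 s == del2 t %[mod k])).+1.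
pose F0 a := \sum_(j < a) (j == 0 %[mod k]); pose F1 a := \sum_(j < a) (j == 1 %[mod k]).
have key b : P b.+1 * F0 b.+1 = brise k 1 b.+1 * (F1 b.+1).+1.
  elim: b => [|b IH].
    by rewrite /P /F0 /F1 /brise !big_ord_recl !big_ord0 /= div0n !modn_small.
  rewrite /P big_ord_recr /= -/(P b.+1).
  have -> : \sum_(s < b.+1) (del2 s == b.+1 %[mod k]) =
     (b.+1 == 1 %[mod k]) + (b.+1 %/ k - (b.+1 == 0 %[mod k])).
    rewrite -sum_mod_self !big_ord_recl /= [b.+1 %% k == _]eq_sym [in X in _ - X]eq_sym; congr (_ + _).
    by rewrite addKn.
  have -> : F0 b.+2 = F0 b.+1 + (b.+1 == 0 %[mod k]) by rewrite /F0 big_ord_recr.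
  have -> : F1 b.+2 = F1 b.+1 + (b.+1 == 1 %[mod k]) by rewrite /F1 big_ord_recr.
  rewrite /brise big_ord_recr /= -/(brise k 1 b.+1).
  case: (eqVneq (b.+1 %% k) (0 %% k)) => e0.
    have -> : (b.+1 == 1 %[mod k]) = false by rewrite e0 !modn_small //.
    have E : F0 b.+1 = b.+1 %/ k by rewrite -sum_mod_self; apply: eq_bigr => s _; rewrite e0.
    have pos : 0 < b.+1 %/ k.
      by rewrite divn_gt0 //; apply: dvdn_leq => //; rewrite /dvdn e0 mod0n.
    rewrite add0n subn1 prednK // addn0 addn1 -E add1n IH.
    by rewrite mulnAC.
  case: (eqVneq (b.+1 %% k) (1 %% k)) => e1.
    have E : F1 b.+1 = b.+1 %/ k by rewrite -sum_mod_self; apply: eq_bigr => s _; rewrite e1.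
    rewrite addn0 subn0 -E !addn1 !add1n mulnAC IH.
    by rewrite mulnAC.
  by rewrite !addn0 subn0 add0n mulnAC IH add1n mulnAC.
have F0p : 0 < F0 a.+1 by rewrite /F0 big_ord_recl eqxx.
have F10 : F1 a.+1 <= F0 a.+1.
  rewrite /F1 /F0 (eq_bigr (fun j : 'I_a.+1 => nat_of_bool (j + 0 == 1 %[mod k]))); first exact: sum_mod_le.
  by move=> j _; rewrite addn0.
rewrite -(leq_pmul2r F0p) key -mulnA mulnCA leq_mul2l; apply/orP; right; lia.
Qed.

(** [del3] puts the colours 0, 0, 1 in front of plain dealing, at the cost (N0 + 1)(N0 + 2)(N1 + 1).
    With q = a %/ k this is at most (q + 2)^2 (q + 3) <= 12 (q + 1)^3, sharp at q = 0, and the three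
    extra factors of [brise] are at least q + 1. *)
Lemma prod_del3 a : 2 < k ->
  \prod_(t < a.+3) (\sum_(s < t) (del3 s == del3 t %[mod k])).+1 <= 12 * brise k 1 a.+3.
Proof.
move=> k2.
pose N0 a := \sum_(j < a) (j == 0 %[mod k]); pose N1 a := \sum_(j < a) (j == 1 %[mod k]).
set P := fun a => \prod_(t < a.+3) (\sum_(s < t) (del3 s == del3 t %[mod k])).+1.
have key b : P b = brise k 1 b * ((N0 b).+1 * (N0 b).+2 * (N1 b).+1).
  elim: b => [|b IH].
    rewrite /P /N0 /N1 /brise !big_ord_recl !big_ord0 /=.
    by rewrite !modn_small // (ltn_trans _ k2).
  rewrite /P big_ord_recr /= -/(P b) IH.
  have -> : \sum_(s < b.+3) (del3 s == b %[mod k]) =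
     2 * (b == 0 %[mod k]) + (b == 1 %[mod k]) + b %/ k.
    rewrite -sum_mod_self !big_ord_recl /= ![_ == b %% k]eq_sym.
    rewrite (eq_bigr (fun i : 'I_b => nat_of_bool (i == b %[mod k]))); last by move=> i _.
    by lia.
  rewrite /brise big_ord_recr /= -/(brise k 1 b) /N0 /N1 !big_ord_recr /=.
  rewrite -/(N0 b) -/(N1 b).
  case: (eqVneq (b %% k) (0 %% k)) => e0.
    have -> : (b == 1 %[mod k]) = false by rewrite e0 !modn_small // (ltn_trans _ k2).
    have E : N0 b = b %/ k by rewrite -sum_mod_self; apply: eq_bigr => s _; rewrite e0.
    rewrite -E; nia.
  case: (eqVneq (b %% k) (1 %% k)) => e1.
    have E : N1 b = b %/ k by rewrite -sum_mod_self; apply: eq_bigr => s _; rewrite e1.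
    rewrite -E; nia.
  by rewrite !addn0; nia.
rewrite -/(P a) key /brise 3!big_ord_recr /= -/(brise k 1 a).
have N10 : N1 a <= N0 a.
  rewrite /N1 /N0 (eq_bigr (fun j : 'I_a => nat_of_bool (j + 0 == 1 %[mod k]))); first exact: sum_mod_le.
  by move=> j _; rewrite addn0.
have N0le : N0 a <= (a %/ k).+1.
  elim: a {N10} => [|b IH]; first by rewrite /N0 big_ord0.
  rewrite /N0 big_ord_recr /= -/(N0 b).
  case: (eqVneq (b %% k) (0 %% k)) => e0.
    have -> : N0 b = b %/ k by rewrite -sum_mod_self; apply: eq_bigr => s _; rewrite e0.
    by rewrite addn1 ltnS leq_div2r.
  by rewrite addn0 (leq_trans IH) // ltnS leq_div2r.
have d1 := leq_div2r k (leqnSn a); have d2 := leq_div2r k (leqnSn a.+1).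
rewrite -!mulnA [12 * _]mulnCA leq_mul2l; apply/orP; right.
move: d1 d2 N0le N10; set q := a %/ k; set q1 := a.+1 %/ k; set q2 := a.+2 %/ k.
set x := N0 a; set y := N1 a => d1 d2 hx hy.
have e : x.+1 * (x.+2 * y.+1) <= q.+2 * (q.+3 * q.+2) by rewrite !leq_mul //; lia.
apply: leq_trans e _; rewrite !add1n.
apply: (@leq_trans (12 * (q.+1 * (q.+1 * q.+1)))); first by nia.
by rewrite leq_mul2l /= !leq_mul //; lia.
Qed.
End ModCount.

Section Dealing.
Variables (n k : nat) (F R : finType) (f : 'I_n -> F) (row : 'I_n -> R) (pri : F -> nat).
Hypothesis f_row : forall x y, f x = f y -> row x = row y.

(* [dkey] lists the points so that the fibres of [f] are contiguous, fibres of
   smaller [pri] first. *)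
Definition prk (z : F) := pri z * #|F| + enum_rank z.
Definition dkey (x : 'I_n) := prk (f x) * n + x.
Definition didx (x : 'I_n) := rank (fib row (row x)) dkey x.
Definition doff (z : F) (i : R) := #|[set y in fib row i | prk (f y) < prk z]|.

Lemma prk_inj : injective prk.
Proof.
move=> z z' e; apply: enum_rank_inj; apply: val_inj.
have := congr1 (modn^~ #|F|) e.
by rewrite /= /prk !modnMDl !modn_small.
Qed.

Lemma dkey_inj : injective dkey.
Proof.
move=> x y e; apply: val_inj; have := congr1 (modn^~ n) e.
by rewrite /= /dkey !modnMDl !modn_small.
Qed.

Lemma dkey_lt x y : f x <> f y -> (dkey x < dkey y) = (prk (f x) < prk (f y)).
Proof.
move=> ne; have hx := ltn_ord x; have hy := ltn_ord y.
have : prk (f x) != prk (f y) by apply/eqP => /prk_inj.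
rewrite /dkey; set a := prk _; set b := prk _ => /eqP ab.
apply/idP/idP => h; nia.
Qed.

(** Each fibre occupies consecutive positions of its row, starting at [doff]. *)
Lemma didxE x : didx x = doff (f x) (row x) + rank (fib f (f x)) (@nat_of_ord n) x.
Proof.
rewrite /didx /rank /doff addnC -cardsUI [X in _ = _ + X]eq_card0 => [|y]; last first.
  rewrite !inE; apply/negbTE/negP => /and3P[/andP[/eqP -> _] _].
  by rewrite ltnn.
rewrite addn0; apply: eq_card => y; rewrite !inE.
case: (eqVneq (f y) (f x)) => e /=.
  by rewrite (f_row e) eqxx e ltnn andbF orbF /= /dkey e ltn_add2l.
by rewrite dkey_lt //; apply/eqP.
Qed.

Variable col : R -> nat -> 'I_k.
Definition deal (x : 'I_n) := col (row x) (didx x).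

Lemma card_deal_row i p :
  #|[set x in fib row i | deal x == p]| = \sum_(j < #|fib row i|) (col i j == p).
Proof.
rewrite -(@card_rank _ (fib row i) dkey (fun x y _ _ => @dkey_inj x y) (fun j => col i j == p)).
apply: eq_card => x; rewrite !inE; case: eqP => //= e.
by rewrite /deal /didx e.
Qed.

Lemma card_deal p : #|fib deal p| = \sum_i \sum_(j < #|fib row i|) (col i j == p).
Proof.
rewrite -sum1_card (partition_big row xpredT) //=; apply: eq_bigr => i _.
rewrite -card_deal_row -sum1_card; apply: eq_bigl => x.
by rewrite !inE andbC.
Qed.

Lemma card_deal_cell x p :
  #|fib (pairf f deal) (f x, p)| =
  \sum_(t < #|fib f (f x)|) (col (row x) (doff (f x) (row x) + t) == p).
Proof.
rewrite -(@card_rank _ (fib f (f x)) (@nat_of_ord n) (fun x y _ _ => @val_inj _ _ _ x y)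
   (fun j => col (row x) (doff (f x) (row x) + j) == p)).
apply: eq_card => y; rewrite !inE /pairf xpair_eqE; case: eqP => //= e.
by rewrite /deal didxE e (f_row e).
Qed.

Lemma kerg_deal_le (b : F -> nat) :
  (forall x, \prod_(t < #|fib f (f x)|)
     (\sum_(s < t) (col (row x) (doff (f x) (row x) + s) == col (row x) (doff (f x) (row x) + t))).+1
     <= b (f x) * brise k 1 #|fib f (f x)|) ->
  (forall z, 0 < b z) ->
  #|kerg (pairf f deal)| <= (\prod_z b z) * bal k 1 f.
Proof.
move=> h b0; rewrite -W1 W_pair /bal -big_split /=; apply: leq_prod => z _.
case: (set_0Vmem (fib f z)) => [e|[x]].
  rewrite big1 ?muln_gt0 ?b0 ?brise_gt0 // => p _.
  suff -> : fib (pairf f deal) (z, p) = set0 by rewrite cards0 /rise big_ord0.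
  by apply/setP=> y; move/setP/(_ y): e; rewrite !inE xpair_eqE => ->.
rewrite inE => /eqP <-; apply: leq_trans (h x).
rewrite -(prod_fact_count (fun t => col (row x) (doff (f x) (row x) + t))).
by rewrite leq_eqVlt; apply/orP; left; apply/eqP/eq_bigr => p _; rewrite rise1 card_deal_cell.
Qed.

(** Only one fibre per row starts at its first position, so only one per row meets the irregular
    start of [del2]. *)
Lemma card_doff0 : 0 < n ->
  #|[set z | [exists x, (f x == z) && (doff z (row x) == 0)]]| <= #|R|.
Proof.
move=> n0; pose x1 := Ordinal n0.
pose g z := odflt x1 [pick x | (f x == z) && (doff z (row x) == 0)].
have gP z : [exists x, (f x == z) && (doff z (row x) == 0)] -> f (g z) = z /\ doff z (row (g z)) = 0.
  move=> /existsP[x hx]; rewrite /g; case: pickP => [y /andP[/eqP -> /eqP ->]//|/(_ x)].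
  by rewrite hx.
apply: (@leq_card_in _ _ (fun z => row (g z))) => z z'; rewrite !inE => /gP[e1 e2] /gP[e3 e4] e.
apply: prk_inj; case: (ltngtP (prk z) (prk z')) => // lt.
  have : g z \in [set y in fib row (row (g z')) | prk (f y) < prk z'] by rewrite !inE e eqxx e1.
  by rewrite (cards0_eq e4) inE.
have : g z' \in [set y in fib row (row (g z)) | prk (f y) < prk z] by rewrite !inE e eqxx e3.
by rewrite (cards0_eq e2) inE.
Qed.
End Dealing.

(** * Balanced colourings, and dealings whose colours cannot be permuted *)

Definition balanced n k l (c : 'I_n -> 'I_k) := forall p, #|fib c p| = l.

Definition refines n (F E : eqType) (f : 'I_n -> F) (e : 'I_n -> E) :=
  forall x y, f x = f y -> e x = e y.

Lemma balanced_ex n k l (c : 'I_n -> 'I_k) p : balanced l c -> 0 < l -> exists x, c x = p.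
Proof.
move=> cb l0; have : 0 < #|fib c p| by rewrite cb.
by move/card_gt0P=> [x]; rewrite inE => /eqP; exists x.
Qed.

Lemma card_fiber_le (gT : finGroupType) (T : finType) (S K : {group gT}) (phi : gT -> T) :
  (forall g h, g \in S -> h \in S -> phi g = phi h -> (g * h^-1)%g \in K) ->
  #|S| <= #|T| * #|K|.
Proof.
move=> H; rewrite -sum1_card (partition_big phi xpredT) //= -sum_nat_const.
apply: leq_sum => t _.
case: (pickP (fun g => (g \in S) && (phi g == t))) => [h /andP[hS /eqP ht]|h0]; last first.
  by rewrite big_pred0 // => g; rewrite h0.
rewrite sum1dep_card -(card_rcoset K h); apply: subset_leq_card; apply/subsetP=> g.
rewrite inE => /andP[gS /eqP gt]; rewrite mem_rcoset; apply: H => //.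
by rewrite gt ht.
Qed.

Section Deals.
Variables (n k l : nat).
Hypotheses (k1 : 1 < k) (l1 : 1 < l).
Let k0 : 0 < k := ltnW k1.
Let l0 : 0 < l := ltnW l1.

Definition circ (del : nat -> nat) (i : 'I_k) (j : nat) : 'I_k := cmod k0 (i + del j).

Variable c1 : 'I_n -> 'I_k.
Hypothesis c1b : balanced l c1.

(** At a fixed position [j] the [k] rows receive the colours [i + del j], that is, each colour
    exactly once. *)
Lemma circ_balanced del (F : finType) (f : 'I_n -> F) pri :
  balanced l (deal f c1 pri (circ del)).
Proof.
move=> p; rewrite card_deal (eq_bigr (fun i : 'I_k => \sum_(j < l) (i + del j == p %[mod k]))).
  rewrite exchange_big /= (eq_bigr (fun=> 1)) ?sum1_card ?card_ord // => j _.
  exact: (sum_modk k0).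
move=> i _; rewrite c1b; apply: eq_bigr => j _.
by rewrite -(inj_eq val_inj) /= [in RHS](modn_small (ltn_ord p)).
Qed.

Lemma card_circ_row del (F : finType) (f : 'I_n -> F) pri (i p : 'I_k) :
  #|[set x in fib c1 i | deal f c1 pri (circ del) x == p]| = \sum_(j < l) (i + del j == p %[mod k]).
Proof.
rewrite card_deal_row c1b; apply: eq_bigr => j _.
by rewrite -(inj_eq val_inj) /= [in RHS](modn_small (ltn_ord p)).
Qed.

(** The rows are the blocks of [c1], which [kerg f] preserves. An element of [fixg c] permutes the
    colours, and it fixes each, since colour [i + 1] is strictly the most frequent one in row [i].
    Only the first fibre of each of the [k] rows loses a factor 2. *)
Lemma deal_lossy (F : finType) (f : 'I_n -> F) : refines f c1 ->
  exists c : 'I_n -> 'I_k, [/\ balanced l c, kerg f :&: fixg c \subset kerg (pairf f c)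
    & #|kerg (pairf f c)| <= 2 ^ k * bal k 1 f].
Proof.
move=> ref; pose pri (z : F) := 0; exists (deal f c1 pri (circ del2)); split.
- exact: circ_balanced.
- set c := deal _ _ _ _; apply/subsetP=> g; rewrite inE => /andP[/kergP gf /fixgP gc].
  have gr x : c1 (g x) = c1 x by apply: ref.
  apply/kergP=> x; rewrite /pairf gf; congr (_, _).
  (* [i] is the row in which the colour of [x] dominates; adding [k.-1] subtracts one modulo [k]. *)
  have [i ip] : exists i : 'I_k, c x = i + 1 %[mod k].
    exists (cmod k0 (c x + k.-1)); rewrite /= modnDml -addnA.
    by rewrite (_ : k.-1 + 1 = k) ?modnDr //; lia.
  have le : #|[set y in fib c1 i | c y == c x]| <= #|[set y in fib c1 i | c y == c (g x)]|.
    rewrite -(card_imset _ (@perm_inj _ g)); apply: subset_leq_card.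
    by apply/subsetP=> _ /imsetP[y + ->]; rewrite !inE gr gc.
  apply/eqP; rewrite -(inj_eq val_inj) -[_ == _]negbK; apply/negP=> ne.
  move: le; rewrite !card_circ_row leqNgt => /negP; apply.
  have -> : l = l.-1.+1 by rewrite prednK.
  rewrite !big_ord_recl /= ip eqxx.
  have -> : (i + 1 == c (g x) %[mod k]) = false.
    by apply/negbTE; rewrite -ip eq_sym !modn_small //; move: ne.
  rewrite add0n add1n ltnS.
  rewrite [X in X <= _](eq_bigr (fun j : 'I_l.-1 => nat_of_bool (j + (i + 1) == c (g x) %[mod k]))); last first.
    by move=> j _; rewrite /bump /= add1n addnCA addn1 addnS.
  rewrite [X in _ <= X](eq_bigr (fun j : 'I_l.-1 => nat_of_bool (j == 0 %[mod k]))); last first.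
    by move=> j _; rewrite /bump /= add1n eqn_modDl -addn1 (eqn_modDr 1 j 0).
  exact: sum_mod_le.
case: (posnP n) => [n0|n0].
  rewrite -W1 W_pair /bal (_ : \prod_z _ = 1) ?muln_gt0 ?expn_gt0 ?prodn_gt0 // => [z|]; first exact: brise_gt0.
  rewrite big1 // => z _; rewrite big1 // => p _; rewrite eq_card0 /rise ?big_ord0 // => x.
  by have := ltn_ord x; rewrite [X in _ < X]n0.
pose B := [set z | [exists x, (f x == z) && (doff f c1 pri z (c1 x) == 0)]].
apply: leq_trans (_ : (\prod_z (if z \in B then 2 else 1)) * bal k 1 f <= _).
  apply: kerg_deal_le => //; last by move=> z; case: ifP.
  move=> x; case: ifP => [|].
    rewrite inE => /existsP[y /andP[/eqP fy /eqP off0]].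
    rewrite -(ref _ _ fy) off0.
    rewrite (eq_bigr (fun t : 'I_#|fib f (f x)| => (\sum_(s < t) (del2 s == del2 t %[mod k])).+1)).
      exact: prod_del2.
    by move=> t _; congr _.+1; apply: eq_bigr => s _; rewrite /circ cmod_eq eqn_modDl.
  move=> nB; rewrite mul1n -(prod_plain k0 (c1 x + doff f c1 pri (f x) (c1 x))).
  rewrite leq_eqVlt; apply/orP; left; apply/eqP; apply: eq_bigr => t _; congr _.+1; apply: eq_bigr => s _.
  (* Past the first position [del2] is the identity, so these fibres are dealt plainly. *)
  have : 0 < doff f c1 pri (f x) (c1 x).
    rewrite lt0n; apply: contraFN nB => h; rewrite inE; apply/existsP; exists x.
    by rewrite eqxx.
  rewrite /circ cmod_eq -!addnA; case: (doff _ _ _ _ _) => //.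
rewrite leq_mul2r; apply/orP; right; rewrite -big_mkcond /= prod_nat_const leq_exp2l //.
by rewrite -[X in _ <= X]card_ord card_doff0.
Qed.
End Deals.

Lemma fixg_perm n k l (c : 'I_n -> 'I_k) g : balanced l c -> 0 < l -> g \in fixg c ->
  exists s : {perm 'I_k}, forall x, c (g x) = s (c x).
Proof.
move=> cb l0 /fixgP gc.
have ex p : exists x, c x == p by have [x <-] := balanced_ex p cb l0; exists x.
pose h p := c (g (xchoose (ex p))).
have hP x : c (g x) = h (c x) by apply/eqP; rewrite /h gc eq_sym (xchooseP (ex (c x))).
have hinj : injective h.
  move=> p q /eqP; rewrite /h gc => /eqP.
  by rewrite (eqP (xchooseP (ex p))) (eqP (xchooseP (ex q))).
by exists (perm hinj) => x; rewrite permE hP.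
Qed.

Lemma fixg_div n (F : eqType) (c : 'I_n -> F) g h x :
  g \in fixg c -> h \in fixg c -> c (g x) = c (h x) -> c ((g * h^-1)%g x) = c x.
Proof.
move=> gS hS e; have /fixgP hV := groupVr hS.
by apply/eqP; rewrite permM -{2}(permK h x) hV e.
Qed.

Section Deals.
Variables (n k l : nat).
Hypotheses (k1 : 1 < k) (l1 : 1 < l).
Let k0 : 0 < k := ltnW k1.
Let l0 : 0 < l := ltnW l1.

Lemma fixg_le (c : 'I_n -> 'I_k) (G : {group {perm 'I_n}}) :
  balanced l c -> #|G :&: fixg c| <= k`! * #|G :&: kerg c|.
Proof.
move=> cb; have <- : #|{perm 'I_k}| = k`!.
  by rewrite -card_Sn.
pose phi (g : {perm 'I_n}) : {perm 'I_k} :=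
  odflt 1%g [pick s : {perm 'I_k} | [forall x, c (g x) == s (c x)]].
have phiP g : g \in fixg c -> forall x, c (g x) = phi g (c x).
  move=> gc x; rewrite /phi; case: pickP => [s /forallP/(_ x)/eqP //|no].
  have [s sP] := fixg_perm cb l0 gc.
  by have := no s; rewrite (introT forallP) // => y; rewrite sP.
apply: (card_fiber_le (phi := phi)) => g h; rewrite !inE => /andP[gG gS] /andP[hG hS] e.
rewrite groupM ?groupV //=; apply/forallP=> x; apply/eqP; apply: fixg_div; rewrite ?inE //.
by rewrite !phiP ?inE // e.
Qed.

Variable c1 : 'I_n -> 'I_k.
Hypothesis c1b : balanced l c1.

Lemma doff_row pri x : doff c1 c1 pri (c1 x) (c1 x) = 0.
Proof.
rewrite /doff eq_card0 // => y; rewrite !inE; case: eqP => // ->.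
by rewrite ltnn.
Qed.

Lemma sum_del3 a q (i : nat) :
  \sum_(j < a.+3) (i + del3 j == q %[mod k]) =
  2 * (i == q %[mod k]) + (i + 1 == q %[mod k]) + \sum_(j < a) (j + i == q %[mod k]).
Proof.
rewrite !big_ord_recl /= !addn0 -[i %% k == _]/(i == q %[mod k]).
rewrite (eq_bigr (fun j : 'I_a => nat_of_bool (j + i == q %[mod k]))); first by lia.
by move=> j _; rewrite addnC.
Qed.

(** In row [i] the multiplicity [M i p] is largest at [p = i] and next at [p = i + 1], so a
    permutation preserving both partitions rotates rows and colours alike. The row to which it sends
    [x0] determines the rotation, whence the factor [k]. Every row is a single fibre and loses a
    factor 12. *)
Lemma deal_rigid (G : {group {perm 'I_n}}) : 2 < k -> 2 < l ->
  exists c : 'I_n -> 'I_k, [/\ balanced l c,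
     #|G :&: (fixg c1 :&: fixg c)| <= k * #|G :&: kerg (pairf c1 c)|
    & #|kerg (pairf c1 c)| <= 12 ^ k * bal k 1 c1].
Proof.
move=> k2 l2; pose pri (z : 'I_k) := 0; pose c := deal c1 c1 pri (circ k1 del3); exists c.
have ref : refines c1 c1 by [].
have cb : balanced l c by apply: circ_balanced.
split=> //; last first.
  apply: leq_trans (_ : (\prod_(z : 'I_k) 12) * bal k 1 c1 <= _); last by rewrite prod_nat_const card_ord.
  apply: kerg_deal_le => // x; rewrite doff_row c1b.
  rewrite (eq_bigr (fun t : 'I_l => (\sum_(s < t) (del3 s == del3 t %[mod k])).+1)).
    by rewrite -(subnKC l2) addSn addnC addn2; apply: prod_del3.
  by move=> t _; congr _.+1; apply: eq_bigr => s _; rewrite /circ cmod_eq eqn_modDl.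
pose M (i p : 'I_k) := #|[set y in fib c1 i | c y == p]|.
pose a := l - 3; have la : l = a.+3 by rewrite /a; lia.
have ME i p : M i p = 2 * (i == p %[mod k]) + (i + 1 == p %[mod k]) + \sum_(j < a) (j + i == p %[mod k]).
  by rewrite /M (card_circ_row k1 c1b) -sum_del3 -la.
pose N0 := \sum_(j < a) (j == 0 %[mod k]).
have neq1 (i : nat) : (i + 1 == i %[mod k]) = false.
  by rewrite -[i in _ == i %[mod k]]addn0 eqn_modDl !modn_small.
have M0 (i p : 'I_k) : i != p -> M i p < M i i.
  move=> ip; rewrite !ME eqxx neq1.
  have -> : (i == p %[mod k]) = false by apply/negbTE; rewrite !modn_small.
  have := sum_mod_le k0 i p a.
  have -> : \sum_(j < a) (j + i == i %[mod k]) = N0.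
    by apply: eq_bigr => j _; rewrite -{2}[val i]add0n eqn_modDr.
  by rewrite -/N0; case: (i + 1 == p %[mod k]); lia.
have M1 (i p q : 'I_k) : i != p -> (i + 1 == q %[mod k]) -> q != p -> M i p < M i q.
  move=> ip iq qp; rewrite !ME iq.
  have -> : (i == p %[mod k]) = false by apply/negbTE; rewrite !modn_small.
  have -> : (i == q %[mod k]) = false by rewrite -(eqP iq) eq_sym neq1.
  have -> : (i + 1 == p %[mod k]) = false.
    by apply/negbTE; rewrite (eqP iq) !modn_small.
  suff : \sum_(j < a) (j + i == p %[mod k]) <= \sum_(j < a) (j + i == q %[mod k]) by lia.
  case: (a) => [|b]; first by rewrite !big_ord0.
  rewrite !big_ord_recl /= !add0n.
  have -> : (i == p %[mod k]) = false by apply/negbTE; rewrite !modn_small.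
  rewrite add0n; apply: leq_trans (leq_addl _ _).
  rewrite [X in X <= _](eq_bigr (fun j : 'I_b => nat_of_bool (j + (i + 1) == p %[mod k]))); last first.
    by move=> j _; rewrite /bump /= add1n addSnnS addn1.
  rewrite [X in _ <= X](eq_bigr (fun j : 'I_b => nat_of_bool (j == 0 %[mod k]))); first exact: sum_mod_le.
  by move=> j _; rewrite /bump /= add1n addSnnS -(eqP iq) -addn1 -{2}[i + 1]add0n eqn_modDr.
have cell g x : g \in fixg c1 -> g \in fixg c -> M (c1 x) (c x) <= M (c1 (g x)) (c (g x)).
  move=> /fixgP g1 /fixgP gc; rewrite /M -(card_imset _ (@perm_inj _ g)).
  apply: subset_leq_card; apply/subsetP=> _ /imsetP[y + ->].
  by rewrite !inE g1 gc.
have posM (i p : 'I_k) : 0 < M i p -> exists x, c1 x = i /\ c x = p.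
  by move/card_gt0P => [x]; rewrite !inE => /andP[/eqP ? /eqP ?]; exists x.
have exA (i : 'I_k) : exists x, c1 x = i /\ c x = i by apply: posM; rewrite ME eqxx.
have exB (i q : 'I_k) : (i + 1 == q %[mod k]) -> exists x, c1 x = i /\ c x = q.
  by move=> h; apply: posM; rewrite ME h; lia.
have [x0 [x01 x02]] := exA (Ordinal k0).
have rigid u : u \in fixg c1 -> u \in fixg c -> c1 (u x0) = c1 x0 -> u \in kerg (pairf c1 c).
  move=> u1 uc ux0; have /fixgP u1P := u1; have /fixgP ucP := uc.
  (* Diagonal cells go to diagonal cells, the others being strictly smaller. *)
  have A x : c1 x = c x -> c1 (u x) = c (u x).
    move=> e; apply/eqP; apply: contraTT (cell u x u1 uc) => /M0 lt.
    rewrite -ltnNge (leq_trans lt) // e !ME !eqxx !neq1.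
    rewrite leq_eqVlt; apply/orP; left; apply/eqP; congr (_ + _).
    by apply: eq_bigr => j _; rewrite -{2}[val (c1 _)]add0n eqn_modDr -{2}[val (c _)]add0n eqn_modDr.
  (* [y] is a diagonal point in the row of [x]; by [A] it keeps [u x] off the diagonal, and among
     the other colours the successor is strictly the most frequent. *)
  have B x y : c1 x = c y -> c1 y = c y -> c1 x + 1 = c x %[mod k] -> c1 (u x) + 1 = c (u x) %[mod k].
    move=> e1 e2 e3; pose q := cmod k0 (c1 (u x) + 1).
    case: (eqVneq q (c (u x))) => [<-|ne]; first by rewrite /= modn_mod.
    exfalso; have := cell u x u1 uc; rewrite leqNgt => /negP; apply.
    have q1 : c1 (u x) + 1 == q %[mod k] by rewrite /= modn_mod.
    apply: leq_trans (M1 _ _ q _ q1 ne) _.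
      have <- : c1 (u y) = c1 (u x) by apply/eqP; rewrite u1P e1 e2.
      rewrite (A _ e2) ucP -e1; apply/eqP => /(congr1 val) /= e; move: e3; rewrite e => /eqP.
      by rewrite neq1.
    rewrite !ME q1 e3 eqxx.
    have -> : (c1 (u x) == q %[mod k]) = false by rewrite -(eqP q1) eq_sym neq1.
    have -> : (c1 x == c x %[mod k]) = false by rewrite -e3 eq_sym neq1.
    rewrite leq_add2l leq_eqVlt; apply/orP; left; apply/eqP; apply: eq_bigr => j _.
    by rewrite -(eqP q1) -e3 [c1 (u x) + 1]addnC [c1 x + 1]addnC !eqn_modDr.
  (* Walk from row 0, the row of [x0], through successor and diagonal cells alternately. *)
  have C m : m < k -> forall x, c1 x = m :> nat -> c x = m :> nat -> c1 (u x) = m :> nat.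
    elim: m => [|m IH] mk x h1 h2.
      have -> : c1 (u x) = c1 (u x0) by apply/eqP; rewrite u1P x01; apply/eqP/val_inj; rewrite /= h1.
      by rewrite ux0 x01.
    pose i := Ordinal (ltnW mk).
    have [y [y1 y2]] := exA i.
    have iq : i + 1 == c x %[mod k] by rewrite h2 addn1.
    have [z [z1 z2]] := exB _ _ iq.
    have h := B z y; rewrite z1 y1 y2 z2 (eqP iq) in h.
    have {}h := h erefl erefl erefl.
    have e3 : c (u z) = c (u x) by apply/eqP; rewrite ucP z2.
    have e4 : c1 (u z) = c1 (u y) by apply/eqP; rewrite u1P z1 y1.
    have e5 : c1 (u x) = c (u x) by apply: A; apply: val_inj; apply: etrans h1 (esym h2).
    have e6 : c1 (u y) = m :> nat by apply: IH; rewrite ?y1 ?y2 //; apply: ltnW.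
    move: h; rewrite e3 -e5 e4 e6 addn1 !modn_small //; exact: esym.
  apply/kergP=> x; rewrite /pairf; congr (_, _); apply: val_inj.
    have [y [y1 y2]] := exA (c1 x).
    have <- : c1 (u y) = c1 (u x) by apply/eqP; rewrite u1P y1.
    by apply: (C _ (ltn_ord (c1 x))); rewrite ?y1 ?y2.
  have [y [y1 y2]] := exA (c x).
  have <- : c (u y) = c (u x) by apply/eqP; rewrite ucP y2.
  by rewrite -A ?y1 ?y2 //; apply: (C _ (ltn_ord (c x))); rewrite ?y1 ?y2.
rewrite -[X in _ <= X * _]card_ord.
apply: (card_fiber_le (phi := fun g : {perm 'I_n} => c1 (g x0))) => g h.
rewrite 2![in X in X -> _]inE [in X in _ -> X -> _]inE [in X in _ -> X -> _]inE.
move=> /and3P[gG g1 gc] /and3P[hG h1 hc] e; rewrite inE groupM ?groupV //=.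
apply: rigid; rewrite ?groupM ?groupV //; exact: fixg_div.
Qed.
End Deals.

(** * Blocks that are small compared with their number *)

Section Sparse.
Variables (n k l : nat).
Hypotheses (l1 : 1 < l) (lk : l + 2 <= k).
Let k1 : 1 < k. Proof. by move: l1 lk; lia. Qed.
Let k0 : 0 < k := ltnW k1.
Let l0 : 0 < l := ltnW l1.

Definition cdist (i p : nat) := if i <= p then p - i else p + k - i.

Lemma cdist_mod i j p : i < k -> j < k -> p < k -> (i + j == p %[mod k]) = (j == cdist i p).
Proof.
move=> ik jk pk; rewrite (modn_small pk) /cdist.
case: (ltnP (i + j) k) => h; first by rewrite modn_small //; case: ifP; lia.
by rewrite -(subnK h) modnDr modn_small; [case: ifP|]; lia.
Qed.

(** Plain dealing gives row [i] the cyclic interval of [l] colours from [i] on, one point each, so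
    [occ] is the incidence graph of rows and colours. *)
Definition occ (i p : 'I_k) := cdist i p < l.
Definition dif (i j : 'I_k) := #|[set p | occ i p && ~~ occ j p]|.

(* Rows [i] and [j] differ in exactly one column iff they are cyclically adjacent. *)
Lemma dif_succ (i j : 'I_k) : cdist i j = 1 -> dif i j <= 1.
Proof.
move=> e; rewrite -(cards1 i); apply: subset_leq_card; apply/subsetP=> p.
rewrite !inE /occ -(inj_eq val_inj) /=; move: e (ltn_ord i) (ltn_ord j) (ltn_ord p); rewrite /cdist.
by move: l1 lk; do ! case: ifP; lia.
Qed.

Lemma dif_far (i j : 'I_k) : 1 < cdist i j -> cdist i j < k.-1 -> 1 < dif i j.
Proof.
(* [i + e] and [i + e.+1] are the first two colours of row [i] missing from row [j]; the truncated
   subtraction is 0 unless row [j] wraps round into row [i]. *)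
move=> h1 h2; pose e := l + cdist i j - k.
have e1k : e.+1 < k by move: l1 lk h1 h2; rewrite /e; lia.
pose p := cmod k0 (i + e); pose q := cmod k0 (i + e.+1).
have pE : cdist i p = e.
  by apply/eqP; rewrite eq_sym -cdist_mod ?ltn_pmod ?ltn_ord //= ?modn_mod //; lia.
have qE : cdist i q = e.+1.
  by apply/eqP; rewrite eq_sym -cdist_mod ?ltn_pmod ?ltn_ord //= ?modn_mod //; lia.
have pq : p != q by apply/eqP => h; move: pE; rewrite h qE; lia.
apply: leq_trans (_ : #|[set p; q]| <= _); first by rewrite cards2 pq.
apply: subset_leq_card; apply/subsetP=> x; rewrite !inE /occ => /orP[] /eqP ->.
  move: pE h1 h2 (ltn_ord i) (ltn_ord j) (ltn_ord p) l1 lk; rewrite /e /cdist.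
  by move: (nat_of_ord p) => P; do ! case: ifP; lia.
move: qE h1 h2 (ltn_ord i) (ltn_ord j) (ltn_ord q) l1 lk; rewrite /e /cdist.
by move: (nat_of_ord q) => P; do ! case: ifP; lia.
Qed.

Variable c1 : 'I_n -> 'I_k.
Hypothesis c1b : balanced l c1.

(** The induced permutations of rows and colours preserve [occ], hence adjacency of rows. Fixing
    rows 0 and 1 therefore fixes all rows, then all colours, then all points, as a cell holds at
    most one. The images of the two rows take at most [k ^ 2] values. *)
Lemma deal_sparse (G : {group {perm 'I_n}}) :
  exists c : 'I_n -> 'I_k, balanced l c /\ #|G :&: (fixg c1 :&: fixg c)| <= k ^ 2.
Proof.
pose pri (z : 'I_k) := 0; pose c := deal c1 c1 pri (circ k1 id); exists c.
have cb : balanced l c by apply: circ_balanced.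
split=> //.
have ME (i p : 'I_k) : #|[set y in fib c1 i | c y == p]| = (cdist i p < l).
  rewrite (card_circ_row k1 c1b).
  rewrite (eq_bigr (fun j : 'I_l => nat_of_bool (j == cdist i p :> nat))); last first.
    move=> j _; rewrite cdist_mod //.
    by have := ltn_ord j; lia.
  case: ltnP => h.
    by rewrite (bigD1 (Ordinal h)) //= eqxx big1 // => j; rewrite -(inj_eq val_inj) => /negbTE /= ->.
  by rewrite big1 // => j _; have := ltn_ord j; lia.
have occP (i p : 'I_k) : reflect (exists x, c1 x = i /\ c x = p) (occ i p).
  rewrite -[occ i p]lt0b /occ -ME; apply: (iffP card_gt0P) => -[x].
    by rewrite !inE => /andP[/eqP ? /eqP ?]; exists x.
  by move=> [<- <-]; exists x; rewrite !inE !eqxx.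
have [x0 x0P] := balanced_ex (Ordinal k0) c1b l0.
have [x1 x1P] := balanced_ex (Ordinal k1) c1b l0.
have rigid u : u \in fixg c1 -> u \in fixg c -> c1 (u x0) = c1 x0 -> c1 (u x1) = c1 x1 -> u = 1%g.
  move=> u1 uc h0 h1.
  have [rho rhoP] := fixg_perm c1b l0 u1; have [gam gamP] := fixg_perm cb l0 uc.
  have occ_u i p : occ (rho i) (gam p) = occ i p.
    apply/occP/occP => -[x [e1 e2]]; last by exists (u x); rewrite rhoP gamP e1 e2.
    exists (u^-1 x)%g; split.
      by apply: (@perm_inj _ rho); rewrite -rhoP permKV.
    by apply: (@perm_inj _ gam); rewrite -gamP permKV.
  have dif_u i j : dif (rho i) (rho j) <= dif i j.
    rewrite /dif -(card_imset _ (@perm_inj _ (gam^-1)%g)); apply: subset_leq_card.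
    apply/subsetP=> _ /imsetP[q + ->]; rewrite !inE -[q in X in X -> _](permKV gam).
    by rewrite !occ_u.
  have R m : m.+1 < k -> forall i : 'I_k, i <= m.+1 -> rho i = i.
    elim: m => [|m IH] mk i im.
      case: (posnP i) => ip.
        have -> : i = c1 x0 by rewrite x0P; apply: val_inj.
        by rewrite -rhoP.
      have -> : i = c1 x1 by rewrite x1P; apply: val_inj; move: im ip => /=; lia.
      by rewrite -rhoP.
    move: im; rewrite leq_eqVlt => /orP[/eqP im|im]; last by apply: IH => //; apply: ltnW.
    (* [rho i] must be a neighbour of [b] other than [a], and both of these rows are already
       fixed. *)
    pose a := Ordinal (ltnW (ltnW mk)); pose b := Ordinal (ltnW mk).
    have ra : rho a = a by apply: IH => //=; apply: ltnW.
    have rb : rho b = b by apply: IH => //=; apply: ltnW.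
    have ia : rho i != a by rewrite -ra (inj_eq perm_inj) -(inj_eq val_inj) /= im; lia.
    have ib : rho i != b by rewrite -rb (inj_eq perm_inj) -(inj_eq val_inj) /= im; lia.
    have : dif b (rho i) <= 1.
      by rewrite -rb (leq_trans (dif_u _ _)) // dif_succ //= im /cdist; case: ifP; lia.
    rewrite leqNgt => nfar; apply: val_inj => /=; apply/eqP/negPn/negP=> ne.
    move/negP: nfar; apply; apply: dif_far => /=.
      move: ne ia ib (ltn_ord (rho i)); rewrite -!(inj_eq val_inj) /= im /cdist.
      by case: ifP; lia.
    move: ne ia ib (ltn_ord (rho i)); rewrite -!(inj_eq val_inj) /= im /cdist.
    by case: ifP; lia.
  have rid i : rho i = i.
    apply: (R k.-2); first by move: k1; lia.
    by have := ltn_ord i; move: k1; lia.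
  have gid p : gam p = p.
    (* Colour [p] is the only one that occurs in row [p] but not in row [p + 1]. *)
    have hp i := occ_u i p; have := hp p; have := hp (cmod k0 (p + 1)); rewrite !rid /occ.
    have e : cmod k0 (p + 1) = (if p.+1 < k then p.+1 else 0) :> nat.
      rewrite /= addn1; case: ifP => h; first by rewrite modn_small.
      by have -> : p.+1 = k; [have := ltn_ord p; lia|rewrite modnn].
    rewrite e /cdist; move=> h2 h3; apply: val_inj => /=.
    move: h2 h3 (ltn_ord p) (ltn_ord (gam p)) l1 lk.
    move: (nat_of_ord p) (nat_of_ord (gam p)) => P Q.
    by rewrite leqnn subnn l0; do ! case: ifP; rewrite ?leq0n; lia.
  apply/permP=> x; rewrite perm1.
  have e1 : c1 (u x) = c1 x by rewrite rhoP rid.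
  have e2 : c (u x) = c x by rewrite gamP gid.
  have : #|[set y in fib c1 (c1 x) | c y == c x]| <= 1 by rewrite ME; case: (_ < _).
  by move/card_le1P => /(_ x); rewrite !inE !eqxx => /(_ isT (u x)); rewrite !inE e1 e2 !eqxx => /esym/eqP.
have : #|G :&: (fixg c1 :&: fixg c)| <= #|{: 'I_k * 'I_k}| * #|[1 {perm 'I_n}]%g|.
  apply: (card_fiber_le (phi := fun g : {perm 'I_n} => (c1 (g x0), c1 (g x1)))) => g h.
  rewrite 2![in X in X -> _]inE [in X in _ -> X -> _]inE [in X in _ -> X -> _]inE.
  move=> /and3P[gG g1 gc] /and3P[hG h1 hc] [ea eb]; rewrite inE; apply/eqP.
  by apply: rigid; rewrite ?groupM ?groupV //; apply: fixg_div.
by rewrite card_prod card_ord cards1 muln1 mulnn.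
Qed.
End Sparse.

(** * Dealing without loss when enough points are fixed *)

Section Lossless.
Variables (n k l : nat).
Hypotheses (k1 : 1 < k) (nE : n = k * l).
Let k0 : 0 < k := ltnW k1.
Variables (F : finType) (f : 'I_n -> F).

Definition nontriv := [set x | 1 < #|fib f (f x)|].

Lemma triv_fix g x : g \in kerg f -> x \notin nontriv -> g x = x.
Proof.
move=> /kergP gf; rewrite inE -leqNgt => /card_le1P /(_ x); rewrite inE eqxx => /(_ isT (g x)).
by rewrite !inE gf eqxx => /esym/eqP.
Qed.

Lemma sum_mod_mul (p : 'I_k) : \sum_(j < k * l) (j == p %[mod k]) = l.
Proof.
elim: l => [|m IH]; first by rewrite muln0 big_ord0.
rewrite mulnS big_split_ord /=.
rewrite (eq_bigr (fun j : 'I_k => nat_of_bool (j + 0 == p %[mod k]))); last by move=> j _; rewrite addn0.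
rewrite sum_modk // -[in RHS]IH add1n; congr _.+1; apply: eq_bigr => j _; by rewrite modnDl.
Qed.

(** Deal all points as a single row, nontrivial fibres first. The last [k] positions hold points
    fixed by [kerg f] and show every colour, so no colour can move, and plain dealing splits each
    fibre evenly. *)
Lemma deal_lossless : #|nontriv| + k <= n ->
  exists c : 'I_n -> 'I_k, [/\ balanced l c, kerg f :&: fixg c \subset kerg (pairf f c)
    & #|kerg (pairf f c)| <= bal k 1 f].
Proof.
move=> mk; pose pri z := (#|fib f z| <= 1 : nat).
pose row (x : 'I_n) := tt; pose c := deal f row pri (fun _ j => cmod k0 j).
have ref : refines f row by [].
have fibrow i : fib row i = setT by apply/setP=> x; rewrite !inE; case: i.
exists c; split.
- move=> p; rewrite card_deal (big_pred1 tt) => [|[]//].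
  rewrite fibrow cardsT card_ord -[RHS](sum_mod_mul p) nE; apply: eq_bigr => j _.
  by rewrite -(inj_eq val_inj) /= [in RHS](modn_small (ltn_ord p)).
- apply/subsetP=> g; rewrite inE => /andP[gf /fixgP gc].
  apply/kergP=> y; rewrite /pairf (kergP _ _ gf); congr (_, _).
  have [j [jn jm jp]] : exists j, [/\ j < n, #|nontriv| <= j & j = c y %[mod k]].
    exists ((c y + (n - k))); have := ltn_ord (c y).
    have kn : k <= n by apply: leq_trans mk; apply: leq_addl.
    split; [lia|lia|rewrite nE].
    have -> : k * l - k = k * l.-1 by rewrite -{2}[k]muln1 -mulnBr subn1.
    by rewrite mulnC addnC modnMDl.
  have : j \in [seq rank setT (dkey f pri) x | x <- enum [set: 'I_n]].
    rewrite (perm_mem (perm_rank _)) ?mem_iota ?cardsT ?card_ord //.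
    by move=> u v _ _; apply: dkey_inj.
  case/mapP => x _ jx.
  have didxx : didx f row pri x = j by rewrite /didx fibrow.
  have xt : x \notin nontriv.
    apply: contraL jm => xn; rewrite -ltnNge jx.
    apply: leq_ltn_trans (_ : #|nontriv :\ x| < _); last by rewrite [X in _ < X](cardsD1 x) xn.
    apply: subset_leq_card; apply/subsetP=> u; rewrite inE in_setT /= => ku.
    rewrite in_setD1; apply/andP; split; first by apply: contraTneq ku => ->; rewrite ltnn.
    move: xn; rewrite !inE => xn; rewrite ltnNge; apply/negP=> ut.
    have ne : f u <> f x by move=> e; move: xn; rewrite -e ltnNge ut.
    have xn' : (#|fib f (f x)| <= 1) = false by rewrite leqNgt xn.
    move: ku; rewrite (dkey_lt _ ne) /prk /pri ut xn' /= mul0n add0n mul1n.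
    move/(leq_ltn_trans (leq_addr _ _)); rewrite ltnNge => /negP; apply.
    exact: ltnW (ltn_ord _).
  have cx : c x = c y.
    by apply: val_inj; rewrite /c /deal didxx /= jp modn_small.
  have /eqP <- : c (g x) == c (g y) by rewrite gc cx.
  by rewrite (triv_fix gf xt).
apply: leq_trans (_ : (\prod_(z : F) 1) * bal k 1 f <= _); last by rewrite big1_eq mul1n.
apply: kerg_deal_le => // x; rewrite mul1n -(prod_plain k0 (doff f row pri (f x) (row x))).
by rewrite leq_eqVlt; apply/orP; left; apply/eqP; apply: eq_bigr => t _; congr _.+1; apply: eq_bigr.
Qed.

End Lossless.

(** * Random colourings *)

Section Random.
Variables (n k l : nat) (U : {set 'I_n}) (c0 : 'I_n -> 'I_k).
Notation CT := {ffun 'I_n -> 'I_k}.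
Let V := ~: U.

Definition colset : {set CT} :=
  [set c : CT | [forall p, #|fib c p| == l] && [forall x in U, c x == c0 x]].

Lemma colsetP (c : CT) : reflect (balanced l c /\ {in U, c =1 c0}) (c \in colset).
Proof.
rewrite inE; apply: (iffP andP) => -[h1 h2]; split.
- by move=> p; apply/eqP; move/forallP: h1.
- by move=> x xU; apply/eqP; move/forall_inP: h2; apply.
- by apply/forallP=> p; rewrite h1.
- by apply/forall_inP=> x xU; rewrite h2.
Qed.

Definition swapc (c : CT) y w : CT := [ffun x => c (tperm y w x)].

Lemma swapcK c y w : swapc (swapc c y w) y w = c.
Proof. by apply/ffunP=> x; rewrite !ffunE tpermK. Qed.

Lemma swapcD c y w x : x != y -> x != w -> swapc c y w x = c x.
Proof. by move=> h1 h2; rewrite ffunE tpermD // eq_sym. Qed.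

Lemma swapcR c y w : swapc c y w w = c y.
Proof. by rewrite ffunE tpermR. Qed.

Lemma swapc_CC c y w : y \in V -> w \in V -> c \in colset -> swapc c y w \in colset.
Proof.
rewrite ![_ \in V]inE => yU wU /colsetP[cb cU]; apply/colsetP; split=> [p|x xU].
  rewrite -(cb p) -(card_imset _ (@perm_inj _ (tperm y w))); apply: eq_card => x.
  rewrite -[x](tpermK y w) mem_imset; last exact: perm_inj.
  by rewrite !inE ffunE tpermK.
by rewrite swapcD ?cU //; [apply: contraNneq yU | apply: contraNneq wU] => <-.
Qed.

(* Double counting of the pairs [(c, w)]: exchanging the colours of [y c] and [w]
   is injective because [y c] can be read off the result. *)
Lemma swap_count (E E' : {set CT}) (y : CT -> 'I_n) (Ws Q : CT -> {set 'I_n}) D q :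
  (forall c, c \in E' -> D <= #|Ws c|) ->
  (forall c, c \in E -> #|Q c| <= q) ->
  (forall c w, c \in E' -> w \in Ws c ->
     [/\ swapc c (y c) w \in E, y (swapc c (y c) w) = y c & w \in Q (swapc c (y c) w)]) ->
  #|E'| * D <= q * #|E|.
Proof.
move=> hD hq hs.
pose S := [set cw : CT * 'I_n | (cw.1 \in E') && (cw.2 \in Ws cw.1)].
pose T := [set cw : CT * 'I_n | (cw.1 \in E) && (cw.2 \in Q cw.1)].
have cardP (A : {set CT}) (B : CT -> {set 'I_n}) :
    #|[set cw : CT * 'I_n | (cw.1 \in A) && (cw.2 \in B cw.1)]| = \sum_(c in A) #|B c|.
  rewrite -sum1dep_card (eq_bigr (fun c => \sum_(w in B c) 1)); last by move=> c _; rewrite sum1_card.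
  by rewrite pair_big_dep /=.
have hS : #|E'| * D <= #|S| by rewrite cardP -sum_nat_const; apply: leq_sum.
have hT : #|T| <= q * #|E| by rewrite cardP mulnC -sum_nat_const; apply: leq_sum.
apply: leq_trans hS (leq_trans _ hT).
pose th (cw : CT * 'I_n) := (swapc cw.1 (y cw.1) cw.2, cw.2).
have th_inj : {in S &, injective th}.
  move=> [c w] [c' w']; rewrite !inE /= => /andP[h1 h2] /andP[h3 h4] [e ew].
  rewrite ew in h2 e *; congr (_, _).
  have [_ y1 _] := hs c w' h1 h2; have [_ y2 _] := hs c' w' h3 h4.
  have ey : y c = y c' by rewrite -y1 e y2.
  by rewrite -(swapcK c (y c) w') e ey swapcK.
rewrite -(card_in_imset th_inj); apply: subset_leq_card; apply/subsetP=> _ /imsetP[[c w] + ->].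
rewrite inE /= => /andP[h1 h2]; have [a _ b] := hs c w h1 h2.
by rewrite inE /= a b.
Qed.

Variable h : {perm 'I_n}.

Definition ev_mono (xs : seq 'I_n) := [set c in colset | all (fun x => c (h x) == c x) xs].

(** Each [x] costs a factor [l.-1 / D]: exchange the colours of [h x] and of some [w] outside the
    points considered; then [w] is one of the [l.-1] other points coloured like [x]. *)
Lemma card_ev_mono xs D : 0 < l -> uniq (xs ++ map h xs) -> {subset xs ++ map h xs <= V} ->
  D + 2 * size xs <= #|V|.+1 ->
  #|ev_mono xs| * D ^ size xs <= l.-1 ^ size xs * #|colset|.
Proof.
move=> l0; elim: xs => [|x xs IH] un sub hD.
  rewrite !expn0 muln1 mul1n subset_leq_card //; apply/subsetP=> c.
  by rewrite inE => /andP[].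
have {}IH : #|ev_mono xs| * D ^ size xs <= l.-1 ^ size xs * #|colset|.
  apply: IH.
  - move: un; rewrite /= mem_cat inE cat_uniq => /and3P[_].
    rewrite /= cat_uniq negb_or => u1 /and3P[/andP[_ u2] _ u3].
    by rewrite u1 u2 u3.
  - move=> y; rewrite mem_cat => /orP[] yy; apply: sub; rewrite /= !inE mem_cat !inE yy ?orbT //.
  - by move: hD => /=; lia.
have : #|ev_mono (x :: xs)| * D <= l.-1 * #|ev_mono xs|.
  pose A := [set z in (x :: xs) ++ map h xs].
  apply: (@swap_count _ _ (fun=> h x) (fun=> V :\: A) (fun c => [set w | c w == c x] :\ x)).
  - move=> c _; rewrite cardsD.
    have : #|V :&: A| <= #|A| by rewrite subset_leq_card // subsetIr.
    have : #|A| <= size ((x :: xs) ++ map h xs) by rewrite cardsE card_size.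
    by rewrite size_cat /= size_map; move: hD => /=; lia.
  - move=> c; rewrite inE => /andP[/colsetP[cb _] _]; by rewrite -(cb (c x)) [#|fib _ _|](cardsD1 x) [x \in _]inE eqxx.
  move=> c w; rewrite inE => /andP[cC /= /andP[/eqP cx /allP call]].
  rewrite inE => /andP[wA wV]; split=> //.
  + rewrite inE swapc_CC //=; last by apply: sub; rewrite mem_cat inE mem_head orbT.
    apply/allP=> z zxs.
    have hzx : h z != h x.
      rewrite (inj_eq perm_inj); apply: contraTneq un => <-.
      by rewrite /= mem_cat zxs.
    have zhx : z != h x.
      apply: contraTneq un => e; rewrite cat_uniq; apply/negP=> /and3P[_ /hasP[]].
      by exists z; rewrite /= ?e ?mem_head // -e inE zxs orbT.
    have [zw hzw] : z != w /\ h z != w.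
      by split; apply: contraNneq wA => <-; rewrite inE mem_cat ?inE ?zxs ?map_f ?orbT.
    by rewrite !swapcD ?call.
  have xw : x != w by apply: contraNneq wA => <-; rewrite inE mem_cat mem_head.
  have xhx : x != h x.
    by apply: contraTneq un => e; rewrite /= mem_cat inE -e eqxx orbT.
  by rewrite !inE eq_sym xw swapcR swapcD // cx eqxx.
move=> hst; rewrite /= !expnS.
apply: leq_trans (_ : l.-1 * (#|ev_mono xs| * D ^ size xs) <= _); last by rewrite -mulnA leq_mul2l IH orbT.
by rewrite !mulnA leq_mul2r hst orbT.
Qed.

Lemma card_ev_mono_set (X : {set 'I_n}) d : 1 < l -> X \subset V -> h @: X \subset V ->
  [disjoint X & h @: X] -> d * l.-1 + 2 * #|X| <= #|V|.+1 ->
  #|[set c in colset | [forall x in X, c (h x) == c x]]| * d ^ #|X| <= #|colset|.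
Proof.
move=> l1 XV hXV dis hd.
have un : uniq (enum X ++ map h (enum X)).
  rewrite cat_uniq enum_uniq map_inj_uniq ?enum_uniq ?andbT /=; last exact: perm_inj.
  apply/hasPn=> _ /mapP[x + ->]; rewrite !mem_enum => xX; apply/negP=> hX.
  by move/disjoint_setI0/setP/(_ (h x)): dis; rewrite !inE hX imset_f.
have sub : {subset enum X ++ map h (enum X) <= V}.
  move=> x; rewrite mem_cat mem_enum => /orP[/(subsetP XV)//|/mapP[z + ->]].
  by rewrite mem_enum => zX; apply: (subsetP hXV); apply: imset_f.
have := card_ev_mono (ltnW l1) un sub; rewrite -cardE => /(_ _ hd).
have -> : ev_mono (enum X) = [set c in colset | [forall x in X, c (h x) == c x]].
  apply/setP=> c; rewrite [in LHS]inE [in RHS]inE; congr (_ && _); apply/allP/forall_inP => H x xX.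
    by apply: H; rewrite mem_enum.
  by apply: H; rewrite -mem_enum.
have lp : 0 < l.-1 ^ #|X| by rewrite expn_gt0 -ltnS prednK ?l1 // ltnW.
by rewrite expnMn mulnA mulnC leq_pmul2l.
Qed.

Variable x : 'I_n.
(* The points sharing the colour of [x]; if [h] maps the block of [x] to another
   block then each of them must be sent to the colour of [h x]. *)
Definition mates (c : CT) := enum [set z in V | (c z == c x) && (z != x)].
Definition ev_moved i := [set c in colset | (c x != c (h x)) && [forall j : 'I_i, c (h (nth x (mates c) j)) == c (h x)]].

(** The image of the next mate is exchanged with a [w] outside the block of [x]. This leaves that
    block, hence [mates], unchanged, and [w] becomes one of the [l.-1] other points coloured like
    [h x]. *)
Lemma card_ev_moved s D : 0 < l -> {in V, forall z, h z \in V} ->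
  (forall c, c \in colset -> s <= size (mates c)) -> D + l + s <= #|V| ->
  #|ev_moved s| * D ^ s <= l.-1 ^ s * #|colset|.
Proof.
move=> l0 hV; elim: s => [|s IH] hs hD.
  rewrite !expn0 muln1 mul1n subset_leq_card //; apply/subsetP=> c.
  by rewrite inE => /andP[].
have {}IH : #|ev_moved s| * D ^ s <= l.-1 ^ s * #|colset|.
  apply: IH; last by lia.
  by move=> c /hs /ltnW.
have : #|ev_moved s.+1| * D <= l.-1 * #|ev_moved s|.
  pose y c := h (nth x (mates c) s).
  pose A (c : CT) := fib c (c x) :|: [set h x] :|: [set h z | z in take s (mates c)].
  apply: (@swap_count _ _ y (fun c => V :\: A c) (fun c => [set w | c w == c (h x)] :\ h x)).
  - move=> c; rewrite inE => /andP[cC _]; rewrite cardsD.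
    have : #|V :&: A c| <= #|A c| by rewrite subset_leq_card // subsetIr.
    have : #|A c| <= l + 1 + s.
      apply: leq_trans (leq_card_setU _ _) _; apply: leq_add.
        apply: leq_trans (leq_card_setU _ _) _; rewrite cards1 leq_add2r.
        by have [-> //] := colsetP c cC.
      apply: leq_trans (leq_imset_card _ _) _; apply: leq_trans (card_size _) _.
      by rewrite size_take; case: ltnP => //; lia.
    by lia.
  - move=> c; rewrite inE => /andP[/colsetP[cb _] _]; by rewrite -(cb (c (h x))) [#|fib _ _|](cardsD1 (h x)) [h x \in _]inE eqxx.
  move=> c w; rewrite inE => /and3P[cC cx /forallP call].
  rewrite inE => /andP[wA wV].
  have szs : s < size (mates c) by apply: hs.
  have zin : nth x (mates c) s \in mates c by apply: mem_nth.
  have := zin; rewrite mem_enum !inE => /and3P[zU /eqP zc zx].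
  have yc : c (y c) = c (h x) by have /eqP := call ord_max.
  have yV : y c \in V by apply: hV; rewrite inE.
  have yx : x != y c by apply: contraNneq cx => {1}->; rewrite yc.
  have xw : x != w by apply: contraNneq wA => <-; rewrite !inE eqxx.
  have wc : c w != c x by apply: contraNneq wA => e; rewrite !inE e eqxx.
  have hxw : h x != w by apply: contraNneq wA => <-; rewrite !inE eqxx orbT.
  have hxy : h x != y c by rewrite (inj_eq perm_inj) eq_sym.
  set c' := swapc c (y c) w.
  have c'x : c' x = c x by rewrite /c' swapcD.
  have c'hx : c' (h x) = c (h x) by rewrite /c' swapcD.
  have c'z : mates c' = mates c.
    rewrite /mates; apply: eq_enum => z; rewrite !inE c'x /c' ffunE.
    case: tpermP => [->|->|//]; first by rewrite yc (negbTE wc) [c (h x) == _]eq_sym (negbTE cx) andbF.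
    by rewrite yc (negbTE wc) [c (h x) == _]eq_sym (negbTE cx) andbF.
  split.
  + apply/andP; split; first by have := swapc_CC yV wV cC; rewrite inE.
    rewrite c'x c'hx cx /=; apply/forallP=> j; rewrite c'z.
    have js : j < size (mates c) by apply: ltn_trans szs.
    rewrite /c' swapcD ?(eqP (call (widen_ord (leqnSn s) j))) //.
      by rewrite (inj_eq perm_inj) nth_uniq ?enum_uniq // ltn_eqF.
    apply: contraNneq wA => <-; rewrite !inE; apply/orP; right; apply: imset_f.
    by rewrite -(nth_take x (ltn_ord j)) mem_nth // size_take szs.
  + by rewrite /y c'z.
  by rewrite eq_sym hxw c'hx swapcR yc eqxx.
move=> hst; rewrite !expnS.
apply: leq_trans (_ : l.-1 * (#|ev_moved s| * D ^ s) <= _); last by rewrite -mulnA leq_mul2l IH orbT.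
by rewrite !mulnA leq_mul2r hst orbT.
Qed.

Lemma card_moved s d : 1 < l -> {in V, forall z, h z \in V} -> x \in V ->
  (forall c, c \in colset -> s < #|fib c (c x) :\: U|) -> d * l.-1 + l + s <= #|V| ->
  #|[set c in colset | (c x != c (h x)) && (h \in fixg c)]| * d ^ s <= #|colset|.
Proof.
move=> l1 hV xV hs hd.
have hz c : c \in colset -> s <= size (mates c).
  move=> /hs; rewrite -cardE.
  rewrite (cardsD1 x) !inE eqxx -in_setC xV add1n ltnS => /leq_trans; apply.
  by apply: subset_leq_card; apply/subsetP=> z; rewrite !inE => /and3P[-> -> ->].
have := card_ev_moved (ltnW l1) hV hz hd.
have lp : 0 < l.-1 ^ s by rewrite expn_gt0 -ltnS prednK ?l1 // ltnW.
rewrite expnMn mulnA mulnC leq_pmul2l // => /(leq_trans _); apply.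
rewrite leq_mul2r; apply/orP; right; apply: subset_leq_card; apply/subsetP=> c.
rewrite inE => /and3P[cC cx /fixgP hc]; rewrite inE cC cx /=; apply/forallP=> j.
rewrite hc; have := mem_nth x (leq_trans (ltn_ord j) (hz c cC)).
by rewrite mem_enum inE => /and3P[].
Qed.
End Random.

(** * Choosing a good partition by averaging *)

Section Averages.
Variables (n k l : nat).

Lemma colset_avg U c0 (S : {set {perm 'I_n}}) D N : 0 < #|@colset n k l U c0| ->
  (forall h, h \in S -> #|[set c in colset l U c0 | h \in fixg c]| * D <= N * #|colset l U c0|) ->
  exists2 c, c \in colset l U c0 & #|S :&: fixg c| * D <= N * #|S|.
Proof.
set C := colset l U c0 => C0 hS.
case: (pickP (fun c => (c \in C) && (#|S :&: fixg c| * D <= N * #|S|))) => [c /andP[]|no]; first by exists c.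
exfalso.
have : \sum_(c in C) (N * #|S|).+1 <= \sum_(c in C) #|S :&: fixg c| * D.
  apply: leq_sum => c cC; rewrite ltnNge; have := no c; by rewrite /= cC /= => ->.
rewrite sum_nat_const -big_distrl /=.
have -> : \sum_(c in C) #|S :&: fixg c| = \sum_(h in S) #|[set c in C | h \in fixg c]|.
  rewrite (eq_bigr (fun c : {ffun 'I_n -> 'I_k} => \sum_(h in S) (h \in fixg c))); last first.
    move=> c _; rewrite -sum1_card (eq_bigl (fun h => (h \in S) && (h \in fixg c))).
      by rewrite big_mkcondr; apply: eq_bigr => h _; case: (h \in _).
    by move=> h; rewrite inE.
  rewrite exchange_big /=; apply: eq_bigr => h _.
  rewrite -sum1_card [RHS](eq_bigl (fun c : {ffun 'I_n -> 'I_k} => (c \in C) && (h \in fixg c))).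
    by rewrite big_mkcondr; apply: eq_bigr => c _; case: (h \in _).
  by move=> c; rewrite [LHS]inE.
rewrite big_distrl /= leqNgt => /negP; apply.
apply: leq_ltn_trans (_ : \sum_(h in S) N * #|C| < _); first by apply: leq_sum => h /hS.
by rewrite sum_nat_const mulnS mulnA [#|S| * N]mulnC [_ * #|C|]mulnC -{1}[#|C| * _]add0n ltn_add2r.
Qed.

Lemma colset_pos U c0 : balanced l c0 -> 0 < #|@colset n k l U c0|.
Proof.
move=> cb; apply/card_gt0P; exists (finfun c0); apply/colsetP; split=> [p|x _]; last by rewrite ffunE.
by rewrite -(cb p); apply: eq_card => x; rewrite !inE ffunE.
Qed.

(** Either all points of [X] keep their colour, or one of them is moved to another block and at
    least [s] further points of its block must follow. Each of these [#|X|.+1] events has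
    probability at most 1 / d^s. *)
Lemma card_fixed_le U c0 (h : {perm 'I_n}) (X : {set 'I_n}) s d : 1 < l ->
  {in ~: U, forall z, h z \in ~: U} -> X \subset ~: U -> [disjoint X & h @: X] ->
  (forall c x, c \in @colset n k l U c0 -> x \in X -> s < #|fib c (c x) :\: U|) ->
  d * l.-1 + l + s <= #|~: U| -> d * l.-1 + 2 * #|X| <= #|~: U|.+1 -> s <= #|X| ->
  #|[set c in colset l U c0 | h \in fixg c]| * d ^ s <= #|X|.+1 * #|colset l U c0|.
Proof.
move=> l1 hU XU dis hs h1 h2 sX; set C := colset l U c0.
case: (posnP d) => [->|d0].
  case: s {hs h1 sX} => [|s]; last by rewrite exp0n // muln0.
  rewrite expn0 muln1 (leq_trans (_ : _ <= #|C|)) ?leq_pmull //.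
  by apply: subset_leq_card; apply/subsetP=> c; rewrite inE => /andP[].
pose EB := [set c in C | [forall x in X, c (h x) == c x]].
pose EM x := [set c in C | (c x != c (h x)) && (h \in fixg c)].
have sub : [set c in C | h \in fixg c] \subset EB :|: \bigcup_(x in X) EM x.
  apply/subsetP=> c; rewrite inE => /andP[cC hc]; rewrite in_setU.
  case: (boolP [forall x in X, c (h x) == c x]) => [all|].
    by rewrite /EB inE cC all.
  rewrite negb_forall_in => /exists_inP[x xX ne]; apply/orP; right.
  by apply/bigcupP; exists x; rewrite // inE cC hc eq_sym ne.
have hB : #|EB| * d ^ s <= #|C|.
  apply: leq_trans (card_ev_mono_set c0 l1 XU _ dis h2).
    by rewrite leq_mul2l leq_pexp2l ?orbT.
  by apply/subsetP=> _ /imsetP[x xX ->]; apply: hU; apply: (subsetP XU).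
have hM x : x \in X -> #|EM x| * d ^ s <= #|C|.
  move=> xX; apply: card_moved => //; first exact: (subsetP XU).
  by move=> c cC; apply: hs.
apply: leq_trans (_ : (#|EB| + \sum_(x in X) #|EM x|) * d ^ s <= _).
  rewrite leq_mul2r; apply/orP; right; apply: leq_trans (subset_leq_card sub) _.
  apply: leq_trans (leq_card_setU _ _) _; rewrite leq_add2l.
  elim/big_rec2: _ => [|x a b _ IH]; first by rewrite cards0.
  by apply: leq_trans (leq_card_setU _ _) _; rewrite leq_add2l.
rewrite mulnDl mulSn leq_add // big_distrl /= -sum_nat_const.
exact: leq_sum.
Qed.

Hypotheses (nE : n = k * l) (l1 : 1 < l).
Variables (c0 : 'I_n -> 'I_k).
Hypothesis c0b : balanced l c0.

(** For a point [x] moved by [h] the bound is 1/k + 1/(k - 1)^2: either [h x] has the colour of [x],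
    or further points of the block of [x] must follow, two of them if [l > 2]. *)
Lemma card_fixed_any (h : {perm 'I_n}) : 2 < k -> h != 1%g ->
  #|[set c in colset l set0 c0 | h \in fixg c]| * (k * k.-1 ^ 2) <= (k ^ 2 - k + 1) * #|colset l set0 c0|.
Proof.
move=> k2 h1; have [x hx] : exists x, h x != x.
  apply/existsP; apply: contraNT h1; rewrite negb_exists => /forallP H.
  by apply/eqP/permP=> x; rewrite perm1; apply/eqP; have := H x; rewrite negbK.
set C := colset l set0 c0.
pose EB := [set c in C | [forall y in [set x], c (h y) == c y]].
pose EM := [set c in C | (c x != c (h x)) && (h \in fixg c)].
have cV : #|~: (set0 : {set 'I_n})| = n by rewrite setC0 cardsT card_ord.
have hU : {in ~: (set0 : {set 'I_n}), forall z, h z \in ~: (set0 : {set 'I_n})}.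
  by move=> z; rewrite setC0 !inE.
have sub : #|[set c in C | h \in fixg c]| <= #|EB| + #|EM|.
  apply: leq_trans (leq_card_setU _ _); apply: subset_leq_card; apply/subsetP=> c.
  rewrite inE => /andP[cC hc]; rewrite inE.
  case: (eqVneq (c x) (c (h x))) => e.
    by rewrite /EB inE cC /=; apply/orP; left; apply/forall_inP=> y; rewrite inE => /eqP ->; rewrite e.
  by apply/orP; right; rewrite /EM inE cC hc e.
have dis : [disjoint [set x] & h @: [set x]].
  by rewrite disjoints1 imset_set1 inE eq_sym.
have hB d : d * l.-1 + 2 <= n.+1 -> #|EB| * d <= #|C|.
  move=> hd; have := @card_ev_mono_set n k l set0 c0 h [set x] d l1.
  rewrite cards1 cV expn1; apply => //; rewrite ?muln1 //; apply/subsetP=> z; rewrite setC0 inE //.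
have hM s d : s < l -> d * l.-1 + l + s <= n -> #|EM| * d ^ s <= #|C|.
  move=> sl hd; apply: card_moved => //; rewrite ?cV //; first by rewrite !inE.
  by move=> c /colsetP[cb _]; rewrite setD0 cb.
apply: leq_trans (_ : (#|EB| + #|EM|) * (k * k.-1 ^ 2) <= _); first by rewrite leq_mul2r sub orbT.
case: (ltnP 2 l) => l2.
  have b1 : #|EB| * k <= #|C| by apply: hB; rewrite nE; case: l l1 => // m _; rewrite mulnS /=; lia.
  have b2 : #|EM| * k.-1 ^ 2 <= #|C|.
    apply: hM => //; rewrite nE; case: l l1 => // m _; case: k k2 => // j j2; rewrite /= !mulnS !mulSn; lia.
  have -> : k ^ 2 - k + 1 = k.-1 ^ 2 + k by rewrite !expnS !expn0; case: k k2 => // j _ /=; nia.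
  rewrite mulnDl mulnA [k * _]mulnC mulnA mulnDl.
  apply: leq_add; first by rewrite mulnC leq_mul2l b1 orbT.
  by rewrite mulnC leq_mul2l b2 orbT.
(* Blocks of size 2 leave a single mate; the two probabilities are then at most 1/(2k - 1) and 1/(2k
   - 3). *)
have le2 : l = 2 by apply/eqP; rewrite eqn_leq l2.
have b1 : #|EB| * (2 * k - 1) <= #|C| by apply: hB; rewrite nE le2; lia.
have b2 : #|EM| * (2 * k - 3) <= #|C|.
  by have := hM 1 (2 * k - 3); rewrite expn1; apply; rewrite ?nE le2; lia.
move: b1 b2; move: #|EB| #|EM| #|C| => a b c b1 b2.
have q : 0 < (2 * k - 1) * (2 * k - 3) by move: k2; nia.
rewrite -(leq_pmul2r q).
apply: (@leq_trans (4 * k.-1 * c * (k * k.-1 ^ 2))).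
  rewrite mulnAC leq_mul2r; apply/orP; right.
  have e : 4 * k.-1 = (2 * k - 3) + (2 * k - 1) by lia.
  rewrite e; nia.
rewrite [X in _ <= X]mulnAC mulnAC leq_mul2r; apply/orP; right.
move: k2; case: k => [|[|[|j]]] // _ /=.
have -> : j.+3 ^ 2 - j.+3 + 1 = j * j + 5 * j + 7 by rewrite !expnS !expn0; lia.
have -> : 2 * j.+3 - 1 = 2 * j + 5 by lia.
have -> : 2 * j.+3 - 3 = 2 * j + 3 by lia.
have -> : (j * j + 5 * j + 7) * ((2 * j + 5) * (2 * j + 3)) =
   4 * j.+2 * (j.+3 * j.+2 ^ 2) + (3 * (j * j) + 11 * j + 9) by rewrite !expnS !expn0; lia.
exact: leq_addr.
Qed.

Lemma generic_step (H : {group {perm 'I_n}}) : 2 < k ->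
  exists c : 'I_n -> 'I_k, balanced l c /\
    #|H :&: fixg c|.-1 * (k * k.-1 ^ 2) <= (k ^ 2 - k + 1) * #|H|.-1.
Proof.
move=> k2; have [|c /colsetP[cb _]] := @colset_avg set0 c0 (H :\ 1%g) (k * k.-1 ^ 2) (k ^ 2 - k + 1) (colset_pos _ c0b).
  by move=> h; rewrite !inE => /andP[h1 _]; apply: card_fixed_any.
have cD (K : {group {perm 'I_n}}) : #|K :\ 1%g| = #|K|.-1 by rewrite (cardsD1 1%g K) group1.
rewrite setIDAC (cD (H :&: fixg c)%G) cD => hc.
by exists c.
Qed.

(* Among all balanced colourings take one that fits the requirement best; otherwise
   a swap would improve it. *)
Lemma balanced_split (S : {set 'I_n}) t : 1 < k -> #|S| <= l -> t \notin S ->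
  exists2 c : 'I_n -> 'I_k, balanced l c & exists2 a, {in S, forall y, c y = a} & c t != a.
Proof.
move=> k1 Sl tS; pose a := Ordinal (ltnW k1).
pose mu (c : {ffun 'I_n -> 'I_k}) := #|[set y in S | c y == a]| + (c t != a).
have C0 : finfun c0 \in colset l set0 c0.
  apply/colsetP; split=> [p|x]; last by rewrite inE.
  by rewrite -(c0b p); apply: eq_card => x; rewrite !inE ffunE.
case: (@arg_maxnP _ _ (mem (colset l set0 c0)) mu C0) => c cC cmax.
have inV (y : 'I_n) : y \in ~: set0 by rewrite !inE.
have sw y w : mu (swapc c y w) <= mu c by apply: cmax; apply: swapc_CC.
have /colsetP[cb _] : c \in colset l set0 c0 by [].
have cS : {in S, forall y, c y = a}.
  move=> y yS; apply/eqP; apply: contraT => ya.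
  have [w wa wS] : exists2 w, c w = a & w \notin S.
    have : ~~ (fib c a \subset S :\ y).
      apply: contraL Sl => /subset_leq_card; rewrite cb (cardsD1 y S) yS add1n -ltnNge.
      by rewrite -ltnS => /leq_trans; apply.
    case/subsetPn => w; rewrite inE => /eqP wa wS; exists w => //.
    by apply: contra wS => wS; rewrite in_setD1 wS andbT; apply: contraNneq ya => <-; rewrite wa.
  have := sw y w; rewrite leqNgt => /negP[].
  rewrite /mu -addSn; apply: leq_add.
    rewrite (cardsD1 y [set y0 in S | swapc c y w y0 == a]) inE yS ffunE tpermL wa eqxx add1n ltnS.
    apply: subset_leq_card; apply/subsetP=> z; rewrite !inE => /andP[zS za].
    have zy : z != y by apply: contraNneq ya => <-.
    by rewrite zy zS swapcD //; apply: contraNneq wS => <-.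
  rewrite ffunE; case: tpermP => [ty|tw|//]; first by rewrite ty yS in tS.
  by rewrite ya; case: (_ != _).
exists c => //; exists a => //; apply: contraT; rewrite negbK => /eqP ta.
have [w wa] : exists w, c w != a.
  have [w wb] := balanced_ex (Ordinal k1) cb (ltnW l1); exists w; by rewrite wb.
have := sw t w; rewrite leqNgt => /negP[].
rewrite /mu ta eqxx addn0 ffunE tpermL wa addn1 ltnS.
apply: subset_leq_card; apply/subsetP=> z; rewrite !inE => /andP[zS za].
rewrite zS swapcD //; first by apply: contraNneq tS => <-.
by apply: contraNneq wa => <-.
Qed.

(** A partition with [x], [z], [h z] in one block and [h x] in another is not preserved by [h]; a
    block must have room for three points. *)
Lemma proper_step (H : {group {perm 'I_n}}) : 1 < k -> 2 < l -> H :!=: 1%g ->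
  exists c : 'I_n -> 'I_k, balanced l c /\ 2 * #|H :&: fixg c| <= #|H|.
Proof.
move=> k1 l2 /trivgPn[h hH h1].
have [x hx] : exists x, h x != x.
  apply/existsP; apply: contraNT h1; rewrite negb_exists => /forallP E.
  by apply/eqP/permP=> x; rewrite perm1; apply/eqP; have := E x; rewrite negbK.
have [z zS] : exists z, z \notin [set x; h x].
  have n2 : 2 < n by rewrite nE; nia.
  apply/existsP; apply: contraTT n2; rewrite negb_exists => /forallP E.
  rewrite -leqNgt -[X in X <= _]card_ord -cardsT.
  have -> : [set: 'I_n] = [set x; h x] by apply/setP=> y; rewrite in_setT; have := E y; rewrite negbK.
  by rewrite cards2; case: (_ != _).
move: zS; rewrite !inE negb_or => /andP[zx zhx].
have [|||c cb [a cS ct]] := @balanced_split [set x; z; h z] (h x) => //.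
- apply: leq_trans (leq_card_setU _ _) _; rewrite cards1.
  by apply: leq_trans (_ : 2 + 1 <= _) => //; rewrite leq_add2r cards2; case: (_ != _).
- by rewrite !inE !negb_or hx eq_sym zhx (inj_eq perm_inj) eq_sym zx.
exists c; split=> //.
have pr : (H :&: fixg c)%G \proper H.
  apply/properP; split; first exact: subsetIl.
  exists h => //; rewrite inE hH /=; apply/fixgP=> /(_ x z).
  rewrite (cS x) ?(cS z) ?(cS (h z)) ?inE ?eqxx ?orbT // (negbTE ct).
  by [].
have := Lagrange (proper_sub pr) => <-; rewrite mulnC leq_mul2l.
by apply/orP; right; rewrite indexg_gt1; case/properP: pr => _ [y yH yn]; apply/subsetPn; exists y.
Qed.
End Averages.

(** * Atom sizes read off from kernel orders, and numerical estimates *)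

Section KernelBounds.
Variables (n k : nat) (F : finType) (f : 'I_n -> F).

(** Fibre by fibre this is 2^a <= (a!)^2 for a >= 2. *)
Lemma nontriv_le : 2 ^ #|nontriv f| <= #|kerg f| ^ 2.
Proof.
rewrite card_kerg -mulnn -big_split /=.
have -> : #|nontriv f| = \sum_z (if 1 < #|fib f z| then #|fib f z| else 0).
  rewrite -sum1_card (partition_big f xpredT) //=; apply: eq_bigr => z _.
  case: ifP => h.
    by rewrite -sum1_card; apply: eq_bigl => x; rewrite !inE; case: eqP => [->|]; rewrite ?h ?andbF.
  by rewrite big_pred0 // => x; rewrite !inE; case: eqP => [->|]; rewrite ?h ?andbF.
rewrite expn_sum; apply: leq_prod => z _.
case: ifP => [|_]; last by rewrite expn0 muln_gt0 fact_gt0.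
case: #|_| => [|[|a]] // _; elim: a => [|a IH] //.
rewrite expnS factS mulnACA; apply: leq_mul => //; lia.
Qed.

Lemma fib_le z : 2 ^ #|fib f z|.-1 <= #|kerg f|.
Proof.
rewrite card_kerg (bigD1 z) //=.
apply: (@leq_trans (#|fib f z|`!)); last by rewrite leq_pmulr // prodn_gt0 // => i; rewrite fact_gt0.
elim: #|_| => [|[|a] IH] //=; rewrite factS expnS leq_mul //.
Qed.
End KernelBounds.

Lemma index_fixg_le n (A B C : {group {perm 'I_n}}) : C \subset A ->
  #|A :&: B| <= #|A : C|%g * #|C :&: B|.
Proof.
move=> CA; rewrite -(leq_pmul2r (cardG_gt0 C)) mulnAC [#|_ : _|%g * _]mulnC (Lagrange CA).
rewrite mul_cardG; apply: leq_mul.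
  by apply: subset_leq_card; rewrite mul_subG // subsetIl.
by apply: subset_leq_card; apply/subsetP=> g; rewrite !inE => /andP[/andP[_ ->] ->].
Qed.

(** Input for [small_num]: the inequality for one unit of [tau], then the one for [tau = 2]. The
    exponent 9 comes from the [9 * tau] generic steps left after the first [2 * tau] partitions. *)
Lemma small_k_num k : 3 < k -> k <= 11 ->
  2 ^ (2 * k) * (k ^ 2 - k + 1) ^ 9 <= (k * k.-1 ^ 2) ^ 9 /\
  2 * k`! * (2 ^ (2 * k) * (k ^ 2 - k + 1) ^ 9) ^ 2 <= 2 ^ k * ((k * k.-1 ^ 2) ^ 9) ^ 2.
Proof.
move=> h1 h2.
have [e|[e|[e|[e|[e|[e|[e|e]]]]]]] :
  k = 4 \/ k = 5 \/ k = 6 \/ k = 7 \/ k = 8 \/ k = 9 \/ k = 10 \/ k = 11 by lia.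
all: rewrite {}e.
- have -> : 4 ^ 2 - 4 + 1 = 13 by []. have -> : 4 * 4.-1 ^ 2 = 36 by []. rewrite !factS fact0; clear; split; lia.
- have -> : 5 ^ 2 - 5 + 1 = 21 by []. have -> : 5 * 5.-1 ^ 2 = 80 by []. rewrite !factS fact0; clear; split; lia.
- have -> : 6 ^ 2 - 6 + 1 = 31 by []. have -> : 6 * 6.-1 ^ 2 = 150 by []. rewrite !factS fact0; clear; split; lia.
- have -> : 7 ^ 2 - 7 + 1 = 43 by []. have -> : 7 * 7.-1 ^ 2 = 252 by []. rewrite !factS fact0; clear; split; lia.
- have -> : 8 ^ 2 - 8 + 1 = 57 by []. have -> : 8 * 8.-1 ^ 2 = 392 by []. rewrite !factS fact0; clear; split; lia.
- have -> : 9 ^ 2 - 9 + 1 = 73 by []. have -> : 9 * 9.-1 ^ 2 = 576 by []. rewrite !factS fact0; clear; split; lia.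
- have -> : 10 ^ 2 - 10 + 1 = 91 by []. have -> : 10 * 10.-1 ^ 2 = 810 by []. rewrite !factS fact0; clear; split; lia.
- have -> : 11 ^ 2 - 11 + 1 = 111 by []. have -> : 11 * 11.-1 ^ 2 = 1100 by []. rewrite !factS fact0; clear; split; lia.
Qed.

Lemma num_rigid k : 11 < k -> 2 * k * 12 ^ k <= (2 ^ 4) ^ k.
Proof.
move=> k12; have -> : 12 ^ k = 4 ^ k * 3 ^ k by rewrite -expnMn.
have -> : (2 ^ 4) ^ k = 4 ^ k * 4 ^ k by rewrite -expnMn.
rewrite mulnCA leq_mul2l; apply/orP; right; rewrite -(subnKC k12).
elim: (k - 12) => [|a IH]; first by rewrite addn0; clear; lia.
rewrite addnS (expnS 3) (expnS 4); move: (3 ^ (12 + a)) (4 ^ (12 + a)) IH => x y IH.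
apply: (@leq_trans (4 * (2 * (12 + a) * x))); last exact: leq_mul.
by rewrite !mulnA leq_mul2r; apply/orP; right; clear; lia.
Qed.

(** Cubing clears the thirds; then induction from [l = 11], where 10^3 outweighs 2^8 and the growth
    of the cube. *)
Lemma num_phi l A : 10 < l -> 3 * A + 6 <= 8 * l -> 2 ^ A * l.+1 <= 10 ^ l.-1.
Proof.
move=> l11 hA; rewrite -(@leq_exp2r _ _ 3) // expnMn -!expnM.
apply: (@leq_trans (2 ^ (8 * l - 6) * l.+1 ^ 3)).
  by rewrite leq_mul2r leq_exp2l // mulnC; apply/orP; right; lia.
rewrite mulnC [l.-1 * 3]mulnC expnM -(subnKC l11); elim: (l - 11) => [|a IH].
  rewrite addn0; have -> : 8 * 11 - 6 = 82 by [].
  by have -> : 11.-1 = 10 by []; clear; lia.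
rewrite addnS /= (_ : 8 * (11 + a).+1 - 6 = 8 + (8 * (11 + a) - 6)); last by lia.
rewrite expnD; apply: (@leq_trans (10 ^ 3 * (10 ^ 3) ^ (11 + a).-1)); last by rewrite -expnS.
apply: (@leq_trans (10 ^ 3 * ((11 + a).+1 ^ 3 * 2 ^ (8 * (11 + a) - 6)))); last by rewrite leq_mul2l IH orbT.
rewrite mulnA mulnA leq_mul2r; apply/orP; right; rewrite !expnS !expn0; clear; nia.
Qed.

(** The left side is at most 2^(3l/4), because [l.+1] is at most 2^(l/2); the right side exceeds a
    power of 8 with exponent about l/2. *)
Lemma num_cond l L m : 23 < l -> 4 * L <= l -> 2 * m <= l -> 2 ^ L * l.+1 < 9 ^ (l - m).-1.
Proof.
move=> l24 hL hm.
have e : l.+1 <= 2 ^ (l %/ 2).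
  have : l.+1 <= (l %/ 2).*2.+2 by lia.
  have : 11 < l %/ 2 by lia.
  move: (l %/ 2) => a a11 /leq_trans; apply; rewrite -(subnKC a11).
  elim: (a - 12) => [|b IH]; first by rewrite addn0; clear; lia.
  by rewrite addnS expnS; lia.
apply: (@leq_ltn_trans (2 ^ (L + l %/ 2))); first by rewrite expnD leq_mul2l e orbT.
apply: (@leq_trans (8 ^ (l - m).-1)); last by case: (_.-1) => // b; rewrite leq_exp2r.
by rewrite -[8]/(2 ^ 3) -expnM ltn_exp2l //; lia.
Qed.

(** * Greedy runs *)

Section Run.
Variables (n k l : nat).
Hypotheses (nE : n = k * l) (k1 : 1 < k) (l1 : 1 < l).
Let k0 : 0 < k := ltnW k1.
Let l0 : 0 < l := ltnW l1.

Variables (G : {group {perm 'I_n}}) (eps : nat).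
(* [eps] is the index of [G] in the symmetric group: a nontrivial [kerg f] contains
   a transposition, so [G] meets it in index [eps]. *)
Hypothesis eps_ge : forall (F : finType) (f : 'I_n -> F), #|kerg f| <= eps * #|G :&: kerg f|.
Hypothesis eps_le : forall (F : finType) (f : 'I_n -> F), eps * #|G :&: kerg f| <= maxn 2 #|kerg f|.
Hypothesis eps2 : eps <= 2.

Variables (N : nat) (c : nat -> 'I_n -> 'I_k).

Fixpoint stab (i : nat) : {group {perm 'I_n}} :=
  if i is j.+1 then (stab j :&: fixg (c j))%G else G.

Hypothesis c_bal : forall i, i < N -> balanced l (c i).
Hypothesis greedy : forall i (c' : 'I_n -> 'I_k), i < N -> balanced l c' ->
  #|stab i.+1| <= #|stab i :&: fixg c'|.

(** The fibres of [f] are the atoms of the first [i] partitions; the target type is left free so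
    that it can grow by pairing. *)
Definition signature i (F : finType) (f : 'I_n -> F) :=
  forall x y, reflect (forall j, j < i -> c j x = c j y) (f x == f y).

Lemma signature1 : signature 1 (c 0).
Proof.
move=> x y; apply: (iffP eqP) => [e j|h]; last exact: h.
by rewrite ltnS leqn0 => /eqP ->.
Qed.

Lemma signatureS i (F : finType) (f : 'I_n -> F) : signature i f -> signature i.+1 (pairf f (c i)).
Proof.
move=> sf x y; rewrite /pairf xpair_eqE; apply: (iffP andP) => [[/sf h /eqP e] j|h].
  by rewrite ltnS leq_eqVlt => /orP[/eqP ->|/h].
by split; [apply/sf => j ji; apply: h; apply: ltnW | apply/eqP/h].
Qed.

Lemma stabP i g : g \in stab i -> g \in G /\ forall j, j < i -> g \in fixg (c j).
Proof.
elim: i => [|i IH] /=; first by split.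
rewrite inE => /andP[/IH[gG h] gc]; split=> // j.
by rewrite ltnS leq_eqVlt => /orP[/eqP ->|/h].
Qed.

Section State.
Variables (i : nat) (F : finType) (f : 'I_n -> F).
Hypothesis sf : signature i f.

Lemma signature_kerg g : g \in kerg f -> forall j, j < i -> g \in kerg (c j).
Proof.
move=> /kergP gf j ji; apply/kergP=> x; apply: (sf (g x) x) => //.
by rewrite gf.
Qed.

Lemma signature_sub : G :&: kerg f \subset stab i.
Proof.
apply/subsetP=> g; rewrite inE => /andP[gG gf].
have := signature_kerg gf; elim: (i) => [|j IH] h //=; rewrite inE IH => [|m mj]; last by apply: h; apply: ltnW.
by apply: (subsetP (kerg_sub_fixg _)); apply: h.
Qed.

Lemma signature_fixg g : g \in stab i -> g \in fixg f.
Proof.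
move=> /stabP[_ h]; apply/fixgP=> x y; apply/sf/sf => e j ji; have /fixgP gc := h j ji.
  by apply/eqP; rewrite -gc e.
by apply/eqP; rewrite gc e.
Qed.

Lemma signature_ref : 0 < i -> refines f (c 0).
Proof. by move=> i0 x y /eqP/sf; apply. Qed.

Lemma signature_moved h : h \notin kerg f -> exists j x, j < i /\ c j (h x) != c j x.
Proof.
rewrite inE negb_forall => /existsP[x hx].
have : ~~ [forall j : 'I_i, c j (h x) == c j x].
  by apply: contra hx => /forallP e; apply/sf => j ji; apply/eqP/(e (Ordinal ji)).
by rewrite negb_forall => /existsP[j hj]; exists j, x.
Qed.

Lemma stab_le_index : #|stab i| <= #|stab i : G :&: kerg f|%g * #|kerg f|.
Proof.
rewrite -(Lagrange signature_sub) mulnC leq_mul2l; apply/orP; right.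
by apply: subset_leq_card; apply: subsetIr.
Qed.

Lemma eps_index : #|stab i : G :&: kerg f|%g * #|kerg f| <= eps * #|stab i|.
Proof.
rewrite -(Lagrange signature_sub) mulnA mulnC leq_mul2r eps_ge orbT //.
Qed.

Lemma stab_next_le (c' : 'I_n -> 'I_k) : i < N -> balanced l c' ->
  kerg f :&: fixg c' \subset kerg (pairf f c') ->
  #|stab i.+1| <= #|stab i : G :&: kerg f|%g * #|G :&: kerg (pairf f c')|.
Proof.
move=> iN cb sub; apply: leq_trans (greedy iN cb) _.
apply: leq_trans (index_fixg_le (fixg c')%G signature_sub) _.
by rewrite leq_mul2l; apply/orP; right; apply: subset_leq_card; rewrite -setIA setIS.
Qed.

Lemma lossy_ex : 0 < i -> i < N -> exists c' : 'I_n -> 'I_k, [/\ balanced l c',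
  kerg f :&: fixg c' \subset kerg (pairf f c') & #|kerg (pairf f c')| <= 2 ^ k * bal k 1 f].
Proof.
move=> i0 iN; apply: (@deal_lossy n k l k1 l1 (c 0)); last exact: signature_ref.
by apply: c_bal; apply: leq_ltn_trans iN.
Qed.
End State.

(** Multiplying by [eps] turns intersections with [G] into full kernels; [1 < rho] absorbs the 2 in
    [eps_le], which stands for a trivial kernel. *)
Lemma step_gen i (F : finType) (f : 'I_n -> F) rho : signature i f -> i < N -> 1 < rho ->
  (exists c' : 'I_n -> 'I_k, [/\ balanced l c',
     kerg f :&: fixg c' \subset kerg (pairf f c') & #|kerg (pairf f c')| <= rho * bal k 1 f]) ->
  #|stab i.+1 : G :&: kerg (pairf f (c i))|%g * #|kerg (pairf f (c i))| <=
  rho * #|stab i : G :&: kerg f|%g * bal k 1 f.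
Proof.
move=> sf iN r1 [c' [cb sub le]]; apply: leq_trans (eps_index (signatureS sf)) _.
apply: leq_trans (_ : eps * (#|stab i : G :&: kerg f|%g * #|G :&: kerg (pairf f c')|) <= _).
  by rewrite leq_mul2l stab_next_le ?orbT.
rewrite mulnCA [rho * _]mulnC -mulnA leq_mul2l; apply/orP; right.
apply: leq_trans (eps_le _) _; rewrite geq_max le andbT.
by apply: leq_trans r1 _; rewrite leq_pmulr // bal_gt0.
Qed.

(** With [j] steps left the weight is taken at [kap = k ^ j], so the run ends with [W 1], the order
    of the kernel. [Pf] is a property of the atoms inherited by refinements. *)
Lemma run_gen rho (Pf : forall F : finType, ('I_n -> F) -> Prop) : 1 < rho ->
  (forall (F : finType) (f : 'I_n -> F) (c' : 'I_n -> 'I_k), Pf F f -> Pf _ (pairf f c')) ->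
  (forall i (F : finType) (f : 'I_n -> F), 0 < i -> i < N -> signature i f -> Pf F f ->
     exists c' : 'I_n -> 'I_k, [/\ balanced l c',
     kerg f :&: fixg c' \subset kerg (pairf f c') & #|kerg (pairf f c')| <= rho * bal k 1 f]) ->
  forall j i (F : finType) (f : 'I_n -> F), 0 < i -> i + j <= N -> signature i f -> Pf F f ->
  k ^ (n * j) * #|stab (i + j)| <= rho ^ j * (#|stab i : G :&: kerg f|%g * W (k ^ j) f).
Proof.
move=> r1 PS ex j; elim: j => [|j IH] i F f i0 ijN sf pf.
  by rewrite muln0 !expn0 !mul1n addn0 W1 stab_le_index.
have iN : i < N by apply: leq_trans ijN; rewrite -addSnnS leq_addr.
have st' := signatureS sf.
have h1 := step_gen sf iN r1 (ex i F f i0 iN sf pf).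
have kj0 : 0 < k ^ j by rewrite expn_gt0 k0.
have h2 := W_step kj0 h1.
rewrite -addSnnS in ijN *.
have h3 := IH i.+1 _ _ (ltn0Sn i) ijN st' (PS _ _ _ pf).
rewrite mulnS expnD -mulnA.
apply: leq_trans (_ : k ^ n * (rho ^ j * (#|stab i.+1 : G :&: kerg (pairf f (c i))|%g * W (k ^ j) (pairf f (c i)))) <= _).
  by rewrite leq_mul2l h3 orbT.
rewrite mulnCA expnSr -mulnA leq_mul2l; apply/orP; right.
by rewrite expnS [X in _ <= X]mulnA.
Qed.

Lemma lossy_run j i (F : finType) (f : 'I_n -> F) : 0 < i -> i + j <= N -> signature i f ->
  k ^ (n * j) * #|stab (i + j)| <= 2 ^ (k * j) * (#|stab i : G :&: kerg f|%g * W (k ^ j) f).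
Proof.
move=> i0 ij sf; rewrite [2 ^ _]expnM.
apply: (@run_gen (2 ^ k) (fun _ _ => True)) => //.
  by rewrite -{1}(expn0 2) ltn_exp2l.
by move=> i' F' f' i0' iN sf' _; apply: lossy_ex sf' _ _.
Qed.

Lemma nontriv_pair (F : finType) (f : 'I_n -> F) (c' : 'I_n -> 'I_k) :
  #|nontriv (pairf f c')| <= #|nontriv f|.
Proof.
apply: subset_leq_card; apply/subsetP=> x; rewrite !inE => h; apply: leq_trans h _.
by apply: subset_leq_card; apply/subsetP=> y; rewrite !inE xpair_eqE => /andP[].
Qed.

Lemma lossless_run j i (F : finType) (f : 'I_n -> F) : 0 < i -> i + j <= N -> signature i f ->
  #|nontriv f| + k <= n ->
  k ^ (n * j) * #|stab (i + j)| <= 2 ^ j * (#|stab i : G :&: kerg f|%g * W (k ^ j) f).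
Proof.
move=> i0 ij sf hm.
apply: (@run_gen 2 (fun _ f => #|nontriv f| + k <= n)) => //.
  by move=> F' f' c' /(leq_trans _); apply; rewrite leq_add2r nontriv_pair.
move=> i' F' f' i0' iN sf' h; have [c' [h1 h2 h3]] := deal_lossless k1 nE h.
by exists c'; split=> //; apply: leq_trans h3 _; rewrite leq_pmull.
Qed.

(** [n * l.-1] is the number of ordered pairs inside the blocks of the first partition. *)
Lemma W_c0 kap : 0 < N -> n * l.-1 <= kap -> 0 < kap -> W kap (c 0) <= 2 * kap ^ n.
Proof.
move=> N0 h kap0; apply: W_le2 => //; apply: leq_trans h; rewrite leq_eqVlt; apply/orP; left.
rewrite (eq_bigr (fun=> \sum_(t < l) t)) => [|z _]; last by rewrite (c_bal N0).
have e a : 2 * (\sum_(t < a) t) = a * a.-1.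
  by elim: a => [|a IH]; rewrite ?big_ord0 // big_ord_recr /= mulnDr IH; case: a {IH} => //= a; lia.
by rewrite sum_nat_const card_ord mulnCA e mulnA -nE.
Qed.

Lemma phase1_fact j : 1 + j <= N -> n * l.-1 <= k ^ j ->
  #|stab (1 + j)| <= 2 * k`! * 2 ^ (k * j).
Proof.
move=> jN h; have N0 : 0 < N by apply: leq_trans jN.
have h1 := lossy_run (ltn0Sn 0) jN signature1.
have r1 : #|stab 1 : G :&: kerg (c 0)|%g <= k`!.
  have sub := signature_sub signature1; rewrite -(leq_pmul2l (cardG_gt0 (G :&: kerg (c 0))%G)) (Lagrange sub) mulnC.
  exact: fixg_le (c_bal N0).
have kj0 : 0 < k ^ j by rewrite expn_gt0 k0.
have h2 := W_c0 N0 h kj0.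
have kn : 0 < k ^ (n * j) by rewrite expn_gt0 k0.
rewrite -(leq_pmul2l kn); apply: leq_trans h1 _.
apply: leq_trans (_ : 2 ^ (k * j) * (k`! * (2 * (k ^ j) ^ n)) <= _).
  by rewrite leq_mul2l leq_mul ?orbT.
rewrite -expnM [j * n]mulnC; move: (k ^ (n * j)) (2 ^ (k * j)) (k`!) => a b e.
by rewrite leq_eqVlt; apply/orP; left; apply/eqP; lia.
Qed.

(** Comparing the second greedy partition with the rigid dealing replaces the initial factor k! of
    [phase1_fact] by [k * 12 ^ k]. *)
Lemma phase1_rigid j : 2 < k -> 2 < l -> 2 + j <= N -> n * l.-1 <= k ^ j.+1 ->
  #|stab (2 + j)| <= 2 * k * 12 ^ k * 2 ^ (k * j).
Proof.
move=> k2 l2 jN h; have N0 : 0 < N by apply: leq_trans jN.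
have N1 : 1 < N by apply: leq_trans jN.
have sf := signatureS signature1; have h1 := lossy_run (ltn0Sn 1) jN sf.
have [c' [cb le1 le2]] := deal_rigid k1 l1 (c_bal N0) G k2 l2.
have r2 : #|stab 2 : G :&: kerg (pairf (c 0) (c 1))|%g * #|kerg (pairf (c 0) (c 1))| <=
    k * 12 ^ k * bal k 1 (c 0).
  apply: leq_trans (eps_index sf) _.
  apply: leq_trans (_ : eps * (k * #|G :&: kerg (pairf (c 0) c')|) <= _).
    rewrite leq_mul2l; apply/orP; right; apply: leq_trans (greedy N1 cb) _.
    by rewrite /= -setIA.
  rewrite mulnCA -mulnA leq_mul2l; apply/orP; right.
  apply: leq_trans (eps_le _) _; rewrite geq_max le2 andbT.
  rewrite -[2]muln1; apply: leq_mul; last by rewrite bal_gt0.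
  by apply: (@leq_trans (12 ^ 1)) => //; rewrite leq_exp2l.
have kj0 : 0 < k ^ j by rewrite expn_gt0 k0.
have h3 := W_step kj0 r2.
have kj1 : 0 < k ^ j.+1 by rewrite expn_gt0 k0.
have h2 := W_c0 N0 h kj1.
have kn : 0 < k ^ (n * j.+1) by rewrite expn_gt0 k0.
rewrite -(leq_pmul2l kn) mulnS expnD -[X in X <= _]mulnA.
apply: leq_trans (_ : k ^ n * (2 ^ (k * j) * (#|stab 2 : G :&: kerg (pairf (c 0) (c 1))|%g * W (k ^ j) (pairf (c 0) (c 1)))) <= _).
  by rewrite leq_mul2l h1 orbT.
rewrite mulnCA; apply: leq_trans (_ : 2 ^ (k * j) * (k * 12 ^ k * (2 * (k ^ j.+1) ^ n)) <= _).
  rewrite leq_mul2l; apply/orP; right; apply: leq_trans h3 _.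
  by rewrite leq_mul2l -expnS h2 orbT.
rewrite -expnD -mulnS -expnM [j.+1 * n]mulnC.
move: (k ^ (n * j.+1)) (2 ^ (k * j)) (12 ^ k) => a b e.
by rewrite leq_eqVlt; apply/orP; left; apply/eqP; lia.
Qed.

Lemma sparse2 : l + 2 <= k -> 1 < N -> #|stab 2| <= k ^ 2.
Proof.
move=> lk N1; have N0 := ltnW N1.
have [c' [cb le]] := deal_sparse l1 lk (c_bal N0) G.
by apply: leq_trans (greedy N1 cb) _; rewrite /= -setIA.
Qed.

Lemma generic_run i j : 2 < k -> i + j <= N ->
  #|stab (i + j)|.-1 * (k * k.-1 ^ 2) ^ j <= (k ^ 2 - k + 1) ^ j * #|stab i|.-1.
Proof.
move=> k2; elim: j => [|j IH] ijN; first by rewrite addn0 !expn0 muln1 mul1n.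
have iN : i + j < N by rewrite -addnS.
have {}IH := IH (ltnW iN); rewrite addnS.
have [c' [cb le]] := generic_step nE l1 (c_bal (leq_ltn_trans (leq0n _) iN)) (stab (i + j)) k2.
have := greedy iN cb; set a := #|stab (i + j).+1|; set b := #|_ :&: _| in le * => ab.
move: (k * k.-1 ^ 2) (k ^ 2 - k + 1) le IH => X Y le IH; rewrite !expnS mulnA.
apply: (@leq_trans (Y * #|stab (i + j)|.-1 * X ^ j)).
  rewrite leq_mul2r; apply/orP; right; apply: leq_trans le.
  by rewrite leq_mul2r; apply/orP; right; lia.
by rewrite -!mulnA leq_mul2l IH orbT.
Qed.

Lemma proper_run i j : 2 < l -> i + j <= N -> (forall m, m < i + j -> stab m :!=: 1%g) ->
  #|stab (i + j)| * 2 ^ j <= #|stab i|.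
Proof.
move=> l2; elim: j => [|j IH] ijN nt; first by rewrite addn0 expn0 muln1.
have iN : i + j < N by rewrite -addnS.
have {}IH := IH (ltnW iN) (fun m h => nt m (leq_trans h (leq_add (leqnn i) (leqnSn j)))); rewrite addnS.
have nt' : stab (i + j) :!=: 1%g by apply: nt; rewrite addnS.
have [c' [cb le]] := proper_step nE l1 (c_bal (leq_ltn_trans (leq0n _) iN)) k1 l2 nt'.
apply: leq_trans IH; rewrite expnS mulnA leq_mul2r; apply/orP; right.
by rewrite mulnC; apply: leq_trans le; rewrite leq_mul2l greedy.
Qed.

Lemma moved_block i (F : finType) (f : 'I_n -> F) h : signature i f -> h \in stab i -> h \notin kerg f -> i <= N ->
  exists B : {set 'I_n}, #|B| = l /\ [disjoint B & h @: B].
Proof.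
move=> sf hH hK iN; have [j [x [ji hx]]] := signature_moved sf hK.
exists (fib (c j) (c j x)); split; first by apply: c_bal; apply: leq_trans iN.
have [_ /(_ j ji) /fixgP hj] := stabP hH.
apply/pred0P=> y; apply/negbTE/negP=> /andP[/= yB /imsetP[z zB yz]].
move: yB zB; rewrite yz !inE => yB zB; move: hx; rewrite -(eqP yB) hj.
by rewrite eq_sym zB.
Qed.

(** At most 2^(3A) elements lie outside [kerg f]. Each moves a whole block off itself and survives
    with probability at most (l + 1)/(k - 2)^(l - 1) <= 2^(-A). *)
Lemma random_move i (F : finType) (f : 'I_n -> F) A : signature i f -> i < N ->
  #|stab i| <= 2 ^ (3 * A) -> 2 ^ A * l.+1 <= (k - 2) ^ l.-1 ->
  #|stab i.+1| <= #|G :&: kerg f| + 2 ^ (2 * A).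
Proof.
move=> sf iN hH hA; have N0 := leq_ltn_trans (leq0n _) iN.
have cV : #|~: (set0 : {set 'I_n})| = n by rewrite setC0 cardsT card_ord.
pose S := stab i :\: kerg f.
have [|c' /colsetP[cb _] hc] := @colset_avg n k l set0 (c 0) S ((k - 2) ^ l.-1) l.+1 (colset_pos _ (c_bal N0)).
  move=> h; rewrite inE => /andP[hK hHs].
  have [B [Bl dis]] := moved_block sf hHs hK (ltnW iN).
  rewrite -Bl; apply: card_fixed_le => //; rewrite ?cV ?Bl //.
  - by move=> z; rewrite setC0 !inE.
  - by rewrite setC0 subsetT.
  - by move=> c'' x /colsetP[cb'' _] _; rewrite setD0 cb'' prednK.
  - rewrite nE; case: k k1 => [|[|k']] // _; case: l l1 => // l' _; rewrite /= !mulSn; lia.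
  - rewrite nE; case: k k1 => [|[|k']] // _; case: l l1 => // l' _; rewrite /= !mulSn; lia.
  - exact: leq_pred.
apply: leq_trans (greedy iN cb) _.
have sub : stab i :&: fixg c' \subset (G :&: kerg f) :|: (S :&: fixg c').
  apply/subsetP=> g; rewrite inE => /andP[gH gc]; rewrite in_setU !in_setI in_setD gH gc !andbT.
  by have [-> _] := stabP gH; case: (g \in kerg f).
apply: leq_trans (subset_leq_card sub) _; apply: leq_trans (leq_card_setU _ _) _; rewrite leq_add2l.
have dp : 0 < (k - 2) ^ l.-1 by apply: leq_trans hA; rewrite muln_gt0 expn_gt0.
rewrite -(leq_pmul2r dp); apply: leq_trans hc _.
apply: (@leq_trans (l.+1 * 2 ^ (3 * A))).
  by rewrite leq_mul2l; apply/orP; right; apply: leq_trans hH; apply: subset_leq_card; apply: subsetDl.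
rewrite (_ : 3 * A = 2 * A + A); last by lia.
by rewrite expnD mulnCA leq_mul2l [l.+1 * _]mulnC hA orbT.
Qed.

(* Either [kerg f] is small and a random partition destroys the rest, or the index of
   [kerg f] is small and an even splitting takes a square root of [#|kerg f|]. *)
Lemma halving i (F : finType) (f : 'I_n -> F) A lam : signature i f -> i < N -> 0 < lam ->
  (exists c' : 'I_n -> 'I_k, [/\ balanced l c',
     kerg f :&: fixg c' \subset kerg (pairf f c') & #|kerg (pairf f c')| <= lam * bal k 1 f]) ->
  (forall z, #|fib f z| <= k * k.-1) ->
  #|stab i| <= 2 ^ (3 * A) -> 2 ^ A * l.+1 <= (k - 2) ^ l.-1 ->
  #|stab i.+1| <= 2 ^ (2 * A + 2) * lam.
Proof.
move=> sf iN lam0 [c' [cb sub le]] small hH hA.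
have hL := Lagrange (signature_sub sf); set x := #|_| in hL; set r := #|_ : _|%g in hL.
(* The order is at most 2^(3A), so a kernel larger than 2^(2A) forces an index of at most 2^A. *)
case: (leqP x (2 ^ (2 * A))) => hx.
  apply: leq_trans (random_move sf iN hH hA) _; rewrite -/x.
  apply: (@leq_trans (2 ^ (2 * A + 2))); last by rewrite leq_pmulr.
  by rewrite expnD (_ : 2 ^ 2 = 4) //; move: hx; set y := 2 ^ _; lia.
have b2 : bal k 1 f ^ 2 <= #|kerg f|.
  rewrite card_kerg /bal -mulnn -big_split /=; apply: leq_prod => z _.
  by rewrite mulnn; apply: brise_sq.
have kx : #|kerg f| <= 2 * x by apply: leq_trans (eps_ge f) _; rewrite leq_mul2r eps2 orbT.
have rA : r <= 2 ^ A.
  rewrite leqNgt; apply/negP=> rA; move: hH; rewrite -hL leqNgt => /negP; apply.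
  by rewrite (_ : 3 * A = 2 * A + A); [rewrite expnD ltn_mul | lia].
apply: leq_trans (stab_next_le sf iN cb sub) _.
apply: (@leq_trans (r * (lam * bal k 1 f))).
  rewrite leq_mul2l; apply/orP; right; apply: leq_trans le.
  by apply: subset_leq_card; apply: subsetIr.
rewrite mulnCA mulnC leq_mul2r; apply/orP; right.
rewrite -(@leq_exp2r _ _ 2) // expnMn -expnM.
apply: (@leq_trans (r ^ 2 * (2 * x))); first by rewrite leq_mul2l (leq_trans b2) ?orbT.
apply: (@leq_trans (2 ^ A * (2 * 2 ^ (3 * A)))).
  rewrite -mulnn -mulnA; apply: leq_mul => //.
  by rewrite mulnCA leq_mul2l mulnC hL.
by rewrite -expnS -expnD leq_exp2l //; lia.
Qed.

(* Colour the nontrivial fibres evenly and all other points at random: an [h] outside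
   [kerg f] still moves more than half a block of the random points. *)
Lemma transversal_kill i (F : finType) (f : 'I_n -> F) : signature i f -> i < N -> 2 < k ->
  2 * #|nontriv f| <= l -> #|stab i| * l.+1 < (k - 3) ^ (l - #|nontriv f|).-1 ->
  exists2 c0 : 'I_n -> 'I_k, #|stab i.+1| <= #|G :&: kerg (pairf f c0)| &
    #|kerg (pairf f c0)| <= bal k 1 f.
Proof.
move=> sf iN k2; set U := nontriv f; set m := #|U| => ml hH.
have mk : m + k <= n by rewrite nE; move: k2 l1 ml; nia.
have [c0 [c0b _ le]] := deal_lossless k1 nE mk; exists c0 => //.
have cV : #|~: U| = n - m by rewrite cardsCs setCK card_ord.
pose S := stab i :\: kerg f; pose s := (l - m).-1.
have sm : s + m < l by rewrite /s; move: l1 ml; lia.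
have colV (c' : {ffun 'I_n -> 'I_k}) p : c' \in colset l U c0 -> s < #|fib c' p :\: U|.
  move=> /colsetP[cb _]; rewrite cardsD cb.
  have : #|fib c' p :&: U| <= m by apply: subset_leq_card; apply: subsetIr.
  by lia.
have [|c' c'C hc] := @colset_avg n k l U c0 S ((k - 3) ^ s) l.+1 (colset_pos _ c0b).
  move=> h; rewrite inE => /andP[hK hHs].
  have [B [Bl dis]] := moved_block sf hHs hK (ltnW iN).
  have Xl : #|B :\: U| <= l by rewrite -Bl; apply: subset_leq_card; apply: subsetDl.
  have Xs : s <= #|B :\: U|.
    rewrite cardsD Bl; have : #|B :&: U| <= m by apply: subset_leq_card; apply: subsetIr.
    by lia.
  (* The points of [U] take away room, hence [k - 3] in place of the [k - 2] of [random_move]. *)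
  have dk : (k - 3) * l.-1 + 2 * l <= n - m.
    rewrite nE; move: ml k2 l1; case: k => [|[|[|k']]] // ml _; case: l ml => // l'.
    by rewrite (_ : k'.+3 - 3 = k') /=; lia.
  apply: leq_trans (card_fixed_le (X := B :\: U) _ _ _ _ _ _ _ _) _ => //.
  - move=> z; rewrite !inE -!leqNgt => hz; apply: leq_trans hz.
    have /fixgP hf := signature_fixg sf hHs.
    rewrite -(card_imset _ (@perm_inj _ (h^-1)%g)); apply: subset_leq_card.
    by apply/subsetP=> _ /imsetP[y yz ->]; rewrite inE -hf permKV; move: yz; rewrite inE.
  - by apply/subsetP=> z; rewrite !inE => /andP[].
  - apply/pred0P=> y; apply/negbTE/negP=> /andP[/= /setDP[yB _] /imsetP[z /setDP[zB _] yz]].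
    by move/pred0P/(_ y): dis; rewrite /= yB yz imset_f.
  - by move=> c'' x cC _; apply: colV.
  - by rewrite cV; move: dk sm; lia.
  - by rewrite cV; move: dk Xl; lia.
  - by rewrite leq_mul2r ltnS Xl orbT.
(* The average is below 1, so nothing of [S] survives. *)
have S0 : S :&: fixg c' = set0.
  apply/eqP; rewrite -cards_eq0; case: #|_| hc => // a hc; exfalso.
  move: hc; rewrite leqNgt => /negP; apply.
  apply: (@leq_ltn_trans (#|stab i| * l.+1)).
    by rewrite mulnC leq_mul2r; apply/orP; right; apply: subset_leq_card; apply: subsetDl.
  by apply: leq_trans hH _; rewrite leq_pmull.
have [cb cU] := colsetP _ _ _ _ c'C.
apply: leq_trans (greedy iN cb) _; apply: subset_leq_card; apply/subsetP=> g.
rewrite inE => /andP[gH gc].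
have gK : g \in kerg f.
  by apply: contraT => gK; have := in_set0 g; rewrite -S0 !in_setI gc in_setD gH gK.
have [gG _] := stabP gH; rewrite inE gG /=; apply/kergP=> y.
have gf := kergP _ _ gK; rewrite /pairf gf; congr (_, _).
case: (boolP (y \in U)) => yU; last by rewrite (triv_fix gK yU).
have gyU : g y \in U by move: yU; rewrite !inE gf.
rewrite -!cU //.
(* Every block contains a point outside [U], which [g] fixes; hence [g] preserves each colour. *)
have /card_gt0P[x] : 0 < #|fib c' (c' y) :\: U| by apply: leq_ltn_trans (colV _ _ c'C).
rewrite !inE => /andP[xU /eqP xy].
have xt : x \notin nontriv f by rewrite inE.
have /eqP <- : c' (g x) == c' (g y) by rewrite (fixgP _ _ gc) xy.
by rewrite (triv_fix gK xt).
Qed.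

(** The first conclusion ends the run when all atoms have at most [k] points; the second restarts
    the potential with a loss of only 2. *)
Lemma transversal_step i (F : finType) (f : 'I_n -> F) : signature i f -> i < N -> 2 < k ->
  2 * #|nontriv f| <= l -> #|stab i| * l.+1 < (k - 3) ^ (l - #|nontriv f|).-1 ->
  #|stab i.+1| <= bal k 1 f /\
  #|stab i.+1 : G :&: kerg (pairf f (c i))|%g * #|kerg (pairf f (c i))| <= 2 * bal k 1 f.
Proof.
move=> sf iN k2 ml hH; have [c0 h1 h2] := transversal_kill sf iN k2 ml hH; split.
  by apply: leq_trans h1 (leq_trans _ h2); apply: subset_leq_card; apply: subsetIr.
apply: leq_trans (eps_index (signatureS sf)) _.
apply: leq_trans (_ : eps * #|G :&: kerg (pairf f c0)| <= _); first by rewrite leq_mul2l h1 orbT.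
apply: leq_trans (eps_le _) _; rewrite geq_max leq_pmulr ?bal_gt0 //=.
by apply: leq_trans h2 _; rewrite leq_pmull.
Qed.

Lemma signature_ex i : 0 < i -> {F : finType & {f : 'I_n -> F & signature i f}}.
Proof.
case: i => // i _; elim: i => [|i [F [f sf]]]; first by exists 'I_k, (c 0); apply: signature1.
by exists (F * 'I_k)%type, (pairf f (c i.+1)); apply: signatureS.
Qed.

Lemma kerg_le_stab i (F : finType) (f : 'I_n -> F) : signature i f -> #|kerg f| <= 2 * #|stab i|.
Proof.
move=> sf; apply: leq_trans (eps_ge f) _; apply: leq_mul => //.
exact: subset_leq_card (signature_sub sf).
Qed.

Lemma signature_nontriv i (F : finType) (f : 'I_n -> F) L : signature i f -> #|stab i| <= 2 ^ L ->
  #|nontriv f| <= 2 * L.+1.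
Proof.
move=> sf hL; rewrite -(@leq_exp2l 2) //; apply: leq_trans (nontriv_le f) _.
rewrite mulnC expnM leq_exp2r // expnS; apply: leq_trans (kerg_le_stab sf) _.
by rewrite leq_mul2l hL.
Qed.

Lemma signature_fib i (F : finType) (f : 'I_n -> F) L z : signature i f -> #|stab i| <= 2 ^ L ->
  #|fib f z| <= L.+2.
Proof.
move=> sf hL; suff : #|fib f z|.-1 <= L.+1 by lia.
rewrite -(@leq_exp2l 2) //; apply: leq_trans (fib_le f z) _.
by rewrite expnS; apply: leq_trans (kerg_le_stab sf) _; rewrite leq_mul2l hL.
Qed.

(** * The contradiction for a run longer than [11 * tau] *)

Hypothesis stab_nt : forall i, i < N -> 1 < #|stab i|.

Lemma generic_run2 i j : 2 < k -> i + j < N -> (k - 2) ^ j < #|stab i|.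
Proof.
move=> k2 ijN; have := generic_run k2 (ltnW ijN); have := stab_nt ijN.
have Hi0 : 0 < #|stab i| := cardG_gt0 _.
have PQ : (k - 2) * (k ^ 2 - k + 1) <= k * k.-1 ^ 2.
  move: k2; case: k => [|[|[|j']]] // _ /=.
  have -> : j'.+3 ^ 2 - j'.+3 + 1 = j' * j' + 5 * j' + 7 by rewrite !expnS !expn0; lia.
  have -> : j'.+3 - 2 = j'.+1 by lia.
  have -> : j'.+3 * j'.+2 ^ 2 = j'.+1 * (j' * j' + 5 * j' + 7) + (j' * j' + 4 * j' + 5).
    by rewrite !expnS !expn0; lia.
  exact: leq_addr.
have P0 : 0 < (k ^ 2 - k + 1) ^ j by rewrite expn_gt0 addn1.
set a := #|stab (i + j)|; set b := #|stab i| in Hi0 * => a1 h.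
have : (k - 2) ^ j * (k ^ 2 - k + 1) ^ j <= (k ^ 2 - k + 1) ^ j * b.-1.
  apply: leq_trans h; rewrite -expnMn; apply: leq_trans (_ : (k * k.-1 ^ 2) ^ j <= _).
    by case: (j) => // j'; rewrite leq_exp2r.
  by rewrite leq_pmull //; move: a1; lia.
by rewrite mulnC leq_pmul2l // => h2; apply: leq_ltn_trans h2 _; rewrite prednK.
Qed.

Variable tau : nat.
Hypotheses (tau1 : k ^ tau.-1 < n) (tau2 : n <= k ^ tau) (tauN : 11 * tau < N) (n4 : 4 < n).

Lemma tau_ge2 : 1 < tau.
Proof.
case: tau tau2 => [|[|t]] //; rewrite ?expn0 ?expn1 => h; first by move: n4 h; lia.
by move: h; rewrite nE; move: k1 l1; nia.
Qed.

Lemma l_le : l <= k ^ tau.-1.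
Proof.
have t := tau_ge2; move: tau2; rewrite nE -{1}(prednK (ltnW t)) expnS leq_pmul2l //.
Qed.

Lemma l_gt : k ^ tau.-2 < l.
Proof.
have t := tau_ge2; move: tau1; rewrite nE (_ : tau.-1 = tau.-2.+1); last by move: t; lia.
by rewrite expnS ltn_pmul2l.
Qed.

(** This makes [k ^ (2 * tau - 1)] an admissible weight in [W_c0], and so fixes the length [2 * tau]
    of the first phase. *)
Lemma nl_le : n * l.-1 <= k ^ (2 * tau - 1).
Proof.
have t := tau_ge2.
rewrite (_ : 2 * tau - 1 = tau + tau.-1); last by move: t; lia.
by rewrite expnD leq_mul // (leq_trans (leq_pred _)) // l_le.
Qed.

Lemma phase1_small : #|stab (2 * tau)| <= 2 * k`! * 2 ^ (k * (2 * tau - 1)).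
Proof.
have t := tau_ge2; have e : 1 + (2 * tau - 1) = 2 * tau by move: t; lia.
have := @phase1_fact (2 * tau - 1); rewrite e; apply; last exact: nl_le.
by move: tauN t; lia.
Qed.

Lemma small_num P Q : 2 ^ (2 * k) * P ^ 9 <= Q ^ 9 ->
  2 * k`! * (2 ^ (2 * k) * P ^ 9) ^ 2 <= 2 ^ k * (Q ^ 9) ^ 2 ->
  P ^ (9 * tau) * (2 * k`! * 2 ^ (k * (2 * tau - 1))) <= Q ^ (9 * tau).
Proof.
have t := tau_ge2; set X := 2 ^ (2 * k) * P ^ 9; set Y := Q ^ 9 => h1 h2.
rewrite -(@leq_pmul2l (2 ^ k)) ?expn_gt0 //.
have -> : 2 ^ k * (P ^ (9 * tau) * (2 * k`! * 2 ^ (k * (2 * tau - 1)))) = 2 * k`! * X ^ tau.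
  rewrite /X expnMn -!expnM (_ : 2 * k * tau = k + k * (2 * tau - 1)); last by move: t; nia.
  by rewrite expnD; move: (2 ^ k) (P ^ _) (k`!) (2 ^ _) => a b d e; lia.
(* [h2] is the case [tau = 2], and [h1] serves each further unit of [tau]. *)
rewrite expnM -/Y -(subnKC t) !expnD [X in X <= _]mulnA [X in _ <= X]mulnA.
apply: leq_mul => //; case: (tau - 2) => // t'; by rewrite leq_exp2r.
Qed.

Lemma case_small_generic : 2 < k ->
  2 ^ (2 * k) * (k ^ 2 - k + 1) ^ 9 <= (k * k.-1 ^ 2) ^ 9 ->
  2 * k`! * (2 ^ (2 * k) * (k ^ 2 - k + 1) ^ 9) ^ 2 <= 2 ^ k * ((k * k.-1 ^ 2) ^ 9) ^ 2 -> False.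
Proof.
move=> k2 h1 h2; have h3 := small_num h1 h2; clear h1 h2.
have t := tau_ge2; have e : 2 * tau + 9 * tau = 11 * tau by lia.
have ijN : 2 * tau + 9 * tau < N by rewrite e.
have := generic_run k2 (ltnW ijN); have := stab_nt ijN; have := phase1_small.
have P0 : 0 < (k ^ 2 - k + 1) ^ (9 * tau) by rewrite expn_gt0 addn1.
have Hi0 : 0 < #|stab (2 * tau)| := cardG_gt0 _.
set a := #|stab (2 * tau + 9 * tau)|; set b := #|stab (2 * tau)| in Hi0 * => hb a1.
move: P0 h3 hb; move: ((k ^ 2 - k + 1) ^ (9 * tau)) ((k * k.-1 ^ 2) ^ (9 * tau)) (2 * k`! * _) => P Q E P0 h3 hb.
rewrite leqNgt => /negP; apply.
apply: (@leq_trans (P * b)); first by rewrite ltn_pmul2l //; move: Hi0; lia.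
apply: (@leq_trans Q); last by rewrite leq_pmull //; move: a1; lia.
by apply: leq_trans h3; rewrite leq_mul2l hb orbT.
Qed.

Lemma case_small_proper : 2 < l -> 2 * k`! * 2 ^ (k * (2 * tau - 1)) <= 2 ^ (9 * tau) -> False.
Proof.
move=> l2 h; have e : 2 * tau + 9 * tau = 11 * tau by lia.
have ijN : 2 * tau + 9 * tau < N by rewrite e.
have nt m : m < 2 * tau + 9 * tau -> stab m :!=: 1%g.
  by move=> /ltn_trans /(_ ijN) /stab_nt; rewrite -cardG_gt1.
have := proper_run l2 (ltnW ijN) nt; have := stab_nt ijN; have := phase1_small.
set a := #|stab (2 * tau + 9 * tau)|; set b := #|stab (2 * tau)| => hb a1.
rewrite leqNgt => /negP; apply.
by apply: leq_ltn_trans (leq_trans hb h) _; rewrite ltn_Pmull // expn_gt0.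
Qed.

Lemma case_k_le11 : k <= 11 -> False.
Proof.
have t := tau_ge2.
have [k2|[k3|k4]] : k = 2 \/ k = 3 \/ 3 < k by move: k1; lia.
- move=> _; apply: case_small_proper; first by move: n4; rewrite nE k2; lia.
  rewrite k2 (_ : 2 * 2`! = 2 ^ 2) // -expnD leq_exp2l //; move: t; lia.
- move=> _; case: (ltnP 2 l) => l2.
    apply: case_small_proper => //; rewrite k3.
    apply: (@leq_trans (2 ^ 4 * 2 ^ (3 * (2 * tau - 1)))); first by rewrite leq_mul2r orbT.
    by rewrite -expnD leq_exp2l //; move: t; lia.
  (* [proper_step] needs [2 < l], so n = 6 is done by numbers: (12/7)^18 exceeds 2 * 3! * 2^9. *)
  have le2 : l = 2 by move: l1 l2; lia.
  have tE : tau = 2.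
    case: tau t tau1 => [|[|[|t']]] // _; rewrite nE k3 le2 /= => h; exfalso.
    move: h; rewrite ltnNge => /negP; apply.
    by apply: (@leq_trans (3 ^ 2)) => //; rewrite leq_exp2l.
  have hb := phase1_small.
  have ijN : 2 * tau + 9 * tau < N by move: tauN; lia.
  have := generic_run (_ : 2 < k) (ltnW ijN); rewrite k3 => /(_ isT).
  have := stab_nt ijN; move: hb; rewrite k3 tE.
  set a := #|stab (2 * 2 + 9 * 2)|; set b := #|stab (2 * 2)|.
  rewrite !factS fact0; move=> hb ha h; have : (12 ^ 18 <= 7 ^ 18 * b.-1).
    by apply: leq_trans h; rewrite leq_pmull //; move: ha; lia.
  by move: hb; rewrite (_ : 3 * (2 * 2 - 1) = 9) //; lia.
move=> k11.
have [h1 h2] := small_k_num k4 k11.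
exact: case_small_generic (ltnW k4) h1 h2.
Qed.

(** Three generic steps after [sparse2] would give (k - 2)^3 < k^2. *)
Lemma case_sparse : 11 < k -> l + 2 <= k -> False.
Proof.
move=> k12 lk; have t := tau_ge2.
have h1 := sparse2 lk (_ : 1 < N).
have h2 := @generic_run2 2 3; move: (h1 ltac:(move: tauN t; lia)) (h2 ltac:(lia) ltac:(move: tauN t; lia)).
move=> a b; have := leq_trans b a; rewrite ltnNge => /negP; apply.
rewrite !expnS !expn0 !muln1; move: k12; set d := k - 2 => k12.
have -> : k = d + 2 by rewrite /d; lia.
have d10 : 9 < d by rewrite /d; lia.
by nia.
Qed.

(** The condition of [random_move], for all exponents up to that of [phase1_dense]. *)
Lemma phi_ok A : 11 < k -> k <= l.+1 -> tau <= 4 -> 3 * A <= (2 * tau + 2) * k + 2 ->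
  2 ^ A * l.+1 <= (k - 2) ^ l.-1.
Proof.
move=> k12 kl t4 hA; have t := tau_ge2; have lg := l_gt.
apply: leq_trans (_ : 10 ^ l.-1 <= _); last first.
  by case: l.-1 => // m; rewrite leq_exp2r //; move: k12; lia.
apply: num_phi; first by move: k12 kl; lia.
have [e|[e|e]] : tau = 2 \/ tau = 3 \/ tau = 4 by move: t t4; lia.
- by move: hA; rewrite e; move: k12 kl; lia.
- by move: hA lg; rewrite e /= expn1; move: k12 kl; lia.
move: hA lg; rewrite e /= => hA lg; have : 12 * k <= k ^ 2 by rewrite -mulnn leq_mul2r k12 orbT.
by move: hA lg k12; set q := k ^ 2; lia.
Qed.

Lemma fib_ok i (F : finType) (f : 'I_n -> F) L z : 11 < k -> tau <= 4 -> signature i f ->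
  #|stab i| <= 2 ^ L -> L <= (2 * tau + 2) * k -> #|fib f z| <= k * k.-1.
Proof.
move=> k12 t4 sf hL hLk; apply: leq_trans (signature_fib z sf hL) _.
apply: (@leq_trans (11 * k)).
  by have : (2 * tau + 2) * k <= 10 * k; [rewrite leq_mul2r; apply/orP; right; lia | lia].
by rewrite mulnC leq_mul2l; apply/orP; right; lia.
Qed.

Lemma halve_lossy i L : 11 < k -> k <= l.+1 -> tau <= 4 -> 0 < i -> i < N ->
  #|stab i| <= 2 ^ L -> L <= (2 * tau + 2) * k ->
  exists2 L', 3 * L' <= 2 * L + 10 + 3 * k & #|stab i.+1| <= 2 ^ L'.
Proof.
move=> k12 kl t4 i0 iN hL hLk; have [F [f sf]] := signature_ex i0.
pose A := (L + 2) %/ 3; have [A1 A2] : L <= 3 * A /\ 3 * A <= L + 2 by rewrite /A; lia.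
exists (2 * A + 2 + k); first by lia.
rewrite [2 ^ _]expnD; apply: (halving sf iN) => //; rewrite ?expn_gt0 //.
- exact: lossy_ex sf i0 iN.
- by move=> z; apply: fib_ok sf hL hLk.
- by apply: leq_trans hL _; rewrite leq_exp2l.
- by apply: phi_ok => //; apply: leq_trans A2 _; rewrite leq_add2r.
Qed.

Lemma halve_lossless i L : 11 < k -> k <= l.+1 -> tau <= 4 -> 0 < i -> i < N ->
  2 * L.+1 + k <= n -> #|stab i| <= 2 ^ L -> L <= (2 * tau + 2) * k ->
  exists2 L', 3 * L' <= 2 * L + 10 & #|stab i.+1| <= 2 ^ L'.
Proof.
move=> k12 kl t4 i0 iN hn hL hLk; have [F [f sf]] := signature_ex i0.
pose A := (L + 2) %/ 3; have [A1 A2] : L <= 3 * A /\ 3 * A <= L + 2 by rewrite /A; lia.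
exists (2 * A + 2); first by lia.
rewrite -[2 ^ _]muln1; apply: (halving sf iN) => //.
- have [|c' [h1 h2 h3]] := deal_lossless k1 nE (f := f).
    by apply: leq_trans hn; rewrite leq_add2r (signature_nontriv sf).
  by exists c'; rewrite mul1n.
- by move=> z; apply: fib_ok sf hL hLk.
- by apply: leq_trans hL _; rewrite leq_exp2l.
- by apply: phi_ok => //; apply: leq_trans A2 _; rewrite leq_add2r.
Qed.

(** 10 is the fixed point of L -> (2L + 10)/3; the inequality is L' - 10 <= (2/3)^j (L - 10) without
    denominators and subtractions. *)
Lemma halve_lossless_run j i L M : 11 < k -> k <= l.+1 -> tau <= 4 -> 0 < i -> i + j <= N ->
  10 <= M -> 2 * M.+1 + k <= n -> M <= (2 * tau + 2) * k -> L <= M -> #|stab i| <= 2 ^ L ->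
  exists2 L', 3 ^ j * L' + 10 * 2 ^ j <= 2 ^ j * L + 10 * 3 ^ j & #|stab (i + j)| <= 2 ^ L'.
Proof.
move=> k12 kl t4 i0 ijN M10 hn Mk; elim: j i L i0 ijN => [|j IH] i L i0 ijN LM hL.
  by exists L; rewrite ?addn0 //; lia.
have iN : i < N by apply: leq_trans ijN; rewrite -addSnnS leq_addr.
have [||L1 e1 h1] := halve_lossless k12 kl t4 i0 iN _ hL; [by lia | by lia |].
rewrite -addSnnS in ijN *.
have [|L' e2 h2] := IH i.+1 L1 (ltn0Sn i) ijN _ h1; first by lia.
exists L' => //; move: e2; rewrite !expnS; move: (3 ^ j) (2 ^ j) => a b e2.
have e3 : b * (3 * L1) <= b * (2 * L + 10) by rewrite leq_mul2l e1 orbT.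
by lia.
Qed.

Lemma phase1_dense : 11 < k -> k <= l.+1 -> #|stab (2 * tau)| <= 2 ^ ((2 * tau + 2) * k).
Proof.
move=> k12 kl; have t := tau_ge2; have e : 2 + (2 * tau - 2) = 2 * tau by move: t; lia.
have := @phase1_rigid (2 * tau - 2); rewrite e => h.
apply: (@leq_trans (2 * k * 12 ^ k * 2 ^ (k * (2 * tau - 2)))).
  apply: h; [lia|lia|by move: tauN; lia|].
  by rewrite (_ : (2 * tau - 2).+1 = 2 * tau - 1) ?nl_le //; move: t; lia.
rewrite (_ : (2 * tau + 2) * k = 4 * k + k * (2 * tau - 2)); last by move: t; nia.
rewrite expnD [2 ^ (4 * k)]expnM leq_mul2r; apply/orP; right; exact: num_rigid.
Qed.

(* Each halving sends [L] to at most [(2 * L + 10) / 3], plus [k] for the first two,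
   for which the nontrivial fibres may still cover too many points. *)
Lemma dense_halved : 11 < k -> k <= l.+1 -> tau <= 4 ->
  exists2 L, #|stab (2 * tau + 12)| <= 2 ^ L &
   9 * L <= k + 90 /\ (tau = 2 -> 13 * L <= k + 130).
Proof.
move=> k12 kl t4; have t := tau_ge2; have h0 := phase1_dense k12 kl.
set L0 := (2 * tau + 2) * k in h0.
have L0k : 6 * k <= L0 <= 10 * k.
  by rewrite /L0 !leq_mul2r; apply/andP; split; apply/orP; right; lia.
have iN j : j < 12 -> 2 * tau + j < N by move: tauN t; lia.
have i0 j : 0 < 2 * tau + j by move: t; lia.
(* The quotient bounds the exponent after two lossy halvings; this inequality makes the lossless
   ones available from there on. *)
have nk : 2 * ((4 * L0 + 15 * k + 50) %/ 9).+1 + k <= n.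
  have lg := l_gt; rewrite /L0.
  have [e|[e|e]] : tau = 2 \/ tau = 3 \/ tau = 4 by move: t t4; lia.
  - have : 11 * k <= n by rewrite nE mulnC leq_mul2l; apply/orP; right; lia.
    by rewrite e; lia.
  - have : 13 * k <= n by rewrite nE mulnC leq_mul2l; apply/orP; right; move: lg; rewrite e /= expn1; lia.
    by rewrite e; lia.
  have : 144 * k <= n.
    rewrite nE mulnC leq_mul2l; apply/orP; right; apply: ltnW; apply: leq_ltn_trans lg; rewrite e /=.
    by rewrite -[144]/(12 ^ 2) leq_exp2r.
  by rewrite e; lia.
rewrite -[2 * tau]addn0 in h0.
have [L1 e1 h1] := halve_lossy k12 kl t4 (i0 0) (iN 0 isT) h0 (leqnn _).
have l1' : L1 <= L0 by lia.
rewrite -addnS in h1; have [L2 e2 h2] := halve_lossy k12 kl t4 (i0 1) (iN 1 isT) h1 l1'.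
pose M := (4 * L0 + 15 * k + 50) %/ 9.
have LM : L2 <= M by rewrite /M; lia.
have M10 : 10 <= M by rewrite /M; lia.
have Mk : M <= L0 by rewrite /M; lia.
rewrite -addnS in h2; have iN2 : 2 * tau + 2 + 10 <= N by move: tauN t; lia.
have [L' e3 h3] := halve_lossless_run k12 kl t4 (i0 2) iN2 M10 nk Mk LM h2.
rewrite -addnA in h3; exists L' => //; split; first by lia.
move=> e; have e6k : L0 = 6 * k by rewrite /L0 e; lia.
by lia.
Qed.

Lemma case_dense_le4 : 11 < k -> k <= l.+1 -> tau <= 4 -> False.
Proof.
move=> k12 kl t4; have t := tau_ge2; have [L hL [L9 L2]] := dense_halved k12 kl t4.
(* For [tau = 2] the generic steps need L <= 18 = 3 (9 * 2 - 12), which [13 * L <= k + 130] yields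
   exactly up to [k = 116]. *)
case: (ltnP k 117) => k117.
  have ijN : (2 * tau + 12) + (9 * tau - 12) < N by move: tauN t; lia.
  have k2 : 2 < k by lia.
  have := leq_trans (generic_run2 k2 ijN) hL; rewrite ltnNge => /negP; apply.
  apply: (@leq_trans (2 ^ (3 * (9 * tau - 12)))).
    rewrite leq_exp2l //.
    have [e|[e|e]] : tau = 2 \/ tau = 3 \/ tau = 4 by lia.
    - by move: (L2 e); rewrite e; lia.
    - by rewrite e; lia.
    - by rewrite e; lia.
  rewrite expnM; case: (9 * tau - 12) => // j; rewrite leq_exp2r //.
  by apply: (@leq_trans 8) => //; lia.
have i0 : 0 < 2 * tau + 12 by rewrite addnS.
have iN : 2 * tau + 12 < N by move: tauN t; lia.
have [F [f sf]] := signature_ex i0.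
have hm := signature_nontriv sf hL.
have k2 : 2 < k by lia.
have hm2 : 2 * #|nontriv f| <= l by lia.
have [|h _] := transversal_step sf iN k2 hm2.
  apply: leq_ltn_trans (_ : 2 ^ L * l.+1 < _); first by rewrite leq_mul2r hL orbT.
  apply: leq_trans (@num_cond l L #|nontriv f| _ _ hm2) _; [lia|lia|].
  by case: (_.-1) => // j; rewrite leq_exp2r //; lia.
have iN' : (2 * tau + 12).+1 < N by move: tauN t; lia.
have := leq_trans (stab_nt iN') h.
(* Atoms have at most [L.+2 <= k] points, so an even splitting separates all points and the
   stabiliser would be trivial. *)
rewrite /bal big1 // => z _; apply: brise_small; apply: leq_trans (signature_fib z sf hL) _; lia.
Qed.

(** Here l > k^(tau - 2) dwarfs (2 tau + 2) k, so the transversal step applies at once. Then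
    [2 * tau] lossless steps bring the order to at most 2^(2 tau + 2), and the [7 * tau - 1] generic
    steps left are too many. *)
Lemma case_dense_ge5 : 11 < k -> k <= l.+1 -> 4 < tau -> False.
Proof.
move=> k12 kl t5; have t := tau_ge2; have hL := phase1_dense k12 kl.
set L := (2 * tau + 2) * k in hL.
have Ll : 4 * L.+1 <= l.
  apply: leq_trans (ltnW l_gt); rewrite /L -(subnKC t5); move: (tau - 5) => a.
  have -> : (5 + a).-2 = a + 3 by lia.
  have e : 4 * ((2 * (5 + a) + 2) * 12).+1 <= 12 ^ (a + 3).
    elim: a => [|a IH]; first by clear; lia.
    by rewrite addSn expnS; move: (12 ^ _) IH => X; clear; lia.
  case: (k) k12 => // k' k12.
  have e2 : 12 ^ (a + 2) <= k'.+1 ^ (a + 2) by rewrite leq_exp2r // addnS.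
  rewrite [a + 3]addnS expnS in e; rewrite [a + 3]addnS expnS.
  have e3 : 4 * ((2 * (5 + a) + 2) * 12).+1 <= 12 * k'.+1 ^ (a + 2) by apply: leq_trans e _; rewrite leq_mul2l.
  move: e3; move: (_ ^ _) => q; nia.
have i0 : 0 < 2 * tau by lia.
have iN : 2 * tau < N by move: tauN t; lia.
have [F [f sf]] := signature_ex i0.
have hm := signature_nontriv sf hL.
have k2 : 2 < k by lia.
have hm2 : 2 * #|nontriv f| <= l by lia.
have [|_ h] := transversal_step sf iN k2 hm2.
  apply: leq_ltn_trans (_ : 2 ^ L * l.+1 < _); first by rewrite leq_mul2r hL orbT.
  apply: leq_trans (@num_cond l L #|nontriv f| _ _ hm2) _; [lia|lia|].
  by case: (_.-1) => // j; rewrite leq_exp2r //; lia.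
have kj0 : 0 < k ^ (2 * tau) by rewrite expn_gt0 k0.
have h3 := W_step kj0 h.
have mk : #|nontriv (pairf f (c (2 * tau)))| + k <= n.
  apply: leq_trans (_ : #|nontriv f| + k <= _); first by rewrite leq_add2r nontriv_pair.
  apply: (@leq_trans (l + l.+1)); first by apply: leq_add => //; lia.
  by apply: (@leq_trans (3 * l)); [lia | rewrite nE leq_mul2r k2 orbT].
have jN : (2 * tau).+1 + 2 * tau <= N by move: tauN t; lia.
have h4 := lossless_run (ltn0Sn _) jN (signatureS sf) mk.
have W2 : W (k ^ (2 * tau).+1) f <= 2 * (k ^ (2 * tau).+1) ^ n.
  apply: W_le2; first by rewrite expn_gt0 k0.
  apply: (@leq_trans (n * n)).
    rewrite big_distrr /= -[X in _ <= X * _](sum_fib f) big_distrl /=; apply: leq_sum => z _.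
    apply: (@leq_trans (#|fib f z| * #|fib f z|)).
      elim: #|_| => [|a IH]; first by rewrite big_ord0.
      by rewrite big_ord_recr /=; lia.
    by rewrite leq_mul2l (leq_trans (max_card _)) ?card_ord ?orbT.
  apply: (@leq_trans (k ^ tau * k ^ tau)); first exact: leq_mul.
  by rewrite -expnD leq_exp2l //; lia.
have fin : #|stab ((2 * tau).+1 + 2 * tau)| <= 2 ^ (2 * tau + 2).
  have kn : 0 < k ^ (n * (2 * tau).+1) by rewrite expn_gt0 k0.
  rewrite -(leq_pmul2l kn) mulnS expnD -[X in X <= _]mulnA.
  apply: leq_trans (_ : k ^ n * (2 ^ (2 * tau) * (#|stab (2 * tau).+1 : G :&: kerg (pairf f (c (2 * tau)))|%g
     * W (k ^ (2 * tau)) (pairf f (c (2 * tau))))) <= _); first by rewrite leq_mul2l h4 orbT.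
  rewrite mulnCA; apply: leq_trans (_ : 2 ^ (2 * tau) * (2 * (2 * (k ^ (2 * tau).+1) ^ n)) <= _).
    rewrite leq_mul2l; apply/orP; right; apply: leq_trans h3 _.
    by rewrite leq_mul2l -expnS W2 orbT.
  rewrite -expnD -mulnS -expnM [(2 * tau).+1 * n]mulnC [2 ^ (2 * tau + 2)]expnD.
  move: (k ^ (n * (2 * tau).+1)) (2 ^ (2 * tau)) => a b.
  by rewrite leq_eqVlt; apply/orP; left; apply/eqP; rewrite (_ : 2 ^ 2 = 4) //; lia.
have ijN : ((2 * tau).+1 + 2 * tau) + (7 * tau - 1) < N by move: tauN t; lia.
have := leq_trans (generic_run2 k2 ijN) fin; rewrite ltnNge => /negP; apply.
apply: (@leq_trans (2 ^ (7 * tau - 1))); first by rewrite leq_exp2l //; lia.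
by case: (7 * tau - 1) => // j; rewrite leq_exp2r //; lia.
Qed.

Lemma run_absurd : False.
Proof.
case: (leqP k 11) => k11; first exact: case_k_le11.
case: (leqP (l + 2) k) => lk; first exact: case_sparse.
have kl : k <= l.+1 by move: lk; lia.
case: (leqP tau 4) => t; first exact: case_dense_le4.
exact: case_dense_ge5.
Qed.
End Run.

(** A nontrivial kernel contains a transposition, and multiplication by it exchanges even and odd
    elements; [maxn 2] covers the trivial kernel. *)
Lemma kerg_Alt n (F : finType) (f : 'I_n -> F) (K := ('Alt_('I_n))%g :&: kerg f) :
  #|kerg f| <= 2 * #|K| /\ 2 * #|K| <= maxn 2 #|kerg f|.
Proof.
case: (boolP (kerg f \subset [1])%g) => [triv|].
  have -> : K = 1%g by apply/trivgP; apply: subset_trans triv; apply: subsetIr.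
  by rewrite (trivgP triv) cards1.
case/subsetPn => g gK; rewrite inE => g1.
have [x gx] : exists x, g x != x.
  apply/existsP; apply: contraNT g1; rewrite negb_exists => /forallP H.
  by apply/eqP/permP=> x; rewrite perm1; apply/eqP; have := H x; rewrite negbK.
pose s := tperm x (g x).
have sK : s \in kerg f.
  by apply/kergP=> y; rewrite /s; case: tpermP => // ->; rewrite (kergP _ _ gK).
have sodd : odd_perm s by rewrite odd_tperm eq_sym.
have e : #|kerg f :\: ('Alt_('I_n))%g| = #|K|.
  rewrite -(card_imset _ (mulIg s)); apply: eq_card => h; apply/imsetP/idP.
    case=> h' /setDP[h1]; rewrite Alt_even negbK => h2 ->; apply/setIP.
    by rewrite Alt_even odd_permM h2 sodd groupM.
  case/setIP; rewrite Alt_even => h1 h2; exists (h * s)%g; last by rewrite -mulgA tperm2 mulg1.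
  by apply/setDP; rewrite Alt_even negbK odd_permM sodd (negbTE h1) groupM.
have {}e : #|kerg f| = 2 * #|K| by rewrite -(cardsID ('Alt_('I_n))%g (kerg f)) e setIC addnn mul2n.
by rewrite e leqnn leq_max leqnn orbT.
Qed.

(** * Partitions and colourings *)

Section Bridge.
Variables k l : nat.
Hypotheses (k1 : 1 < k) (l1 : 1 < l).
Let k0 : 0 < k := ltnW k1.
Let l0 : 0 < l := ltnW l1.
Notation n := (k * l).
Notation Part := {set {set 'I_n}}.

Definition parts (c : 'I_n -> 'I_k) : Part := [set fib c p | p in 'I_k].

Lemma parts_fixP (c : 'I_n -> 'I_k) (g : {perm 'I_n}) : balanced l c ->
  (pact (parts c) g == parts c) = (g \in fixg c).
Proof.
move=> cb; apply/eqP/idP => [e|gc].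
  have mem p : fib c p \in parts c by apply: imset_f.
  apply/fixgP=> x y; apply/eqP/eqP => exy.
    have : fib c (c (g x)) \in pact (parts c) g by rewrite e.
    case/imsetP => _ /imsetP[p _ ->] ep.
    have h z : c (g z) = c (g x) -> c z = p.
      move=> ez; have : g z \in fib c (c (g x)) by rewrite inE ez.
      by rewrite ep => /imsetP[z']; rewrite inE => /eqP <- /perm_inj ->.
    by rewrite h // (h y).
  have : [set g z | z in fib c (c x)] \in parts c.
    by rewrite -e; apply: imset_f.
  case/imsetP => p _ ep.
  have h z : c z = c x -> c (g z) = p.
    move=> ez; have : g z \in [set g z | z in fib c (c x)] by apply: imset_f; rewrite inE ez.
    by rewrite ep inE => /eqP.
  by rewrite h // (h y).
have [s sP] := fixg_perm cb l0 gc.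
have im p : [set g z | z in fib c p] = fib c (s p).
  apply/setP=> y; rewrite inE; apply/imsetP/eqP => [[z + ->]|].
    by rewrite inE sP => /eqP ->.
  rewrite -{1}(permKV g y) sP => /perm_inj ey; exists (g^-1 y)%g; last by rewrite permKV.
  by rewrite inE ey.
apply/setP=> B; apply/imsetP/imsetP => [[_ /imsetP[p _ ->] ->]|[p _ ->]].
  by exists (s p); rewrite // im.
exists (fib c (s^-1 p)%g); first by apply: imset_f.
by rewrite im permKV.
Qed.

Lemma fib_inj (c : 'I_n -> 'I_k) : balanced l c -> injective (fib c).
Proof.
move=> cb p q e; have [x xp] := balanced_ex p cb l0.
have : x \in fib c p by rewrite inE xp.
by rewrite e inE xp => /eqP.
Qed.

Lemma parts_Pi (c : 'I_n -> 'I_k) : balanced l c -> parts c \in Pi k l.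
Proof.
move=> cb; rewrite inE; apply/and3P; split.
- apply/and3P; split.
  + rewrite eqEsubset subsetT /=; apply/subsetP=> x _; apply/bigcupP.
    by exists (fib c (c x)); [apply: imset_f | rewrite inE].
  + apply/trivIsetP => _ _ /imsetP[p _ ->] /imsetP[q _ ->] ne.
    apply/pred0P=> x; apply/negbTE/negP=> /andP[]; rewrite /= !inE => /eqP e1 /eqP e2.
    by rewrite -e1 -e2 eqxx in ne.
  by apply/imsetP=> -[p _ e]; have := cb p; rewrite -e cards0; move: l0; lia.
- by rewrite card_imset ?card_ord //; apply: fib_inj.
by apply/forall_inP=> _ /imsetP[p _ ->]; rewrite cb.
Qed.

Lemma Pi_parts (P : Part) : P \in Pi k l ->
  exists2 c : {ffun 'I_n -> 'I_k}, balanced l c & P = parts c.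
Proof.
rewrite inE => /and3P[/and3P[/eqP cov tI P0] /eqP cP /forall_inP szP].
have inP x : pblock P x \in P by rewrite pblock_mem // cov.
have ltk x : index (pblock P x) (enum P) < k by rewrite -[X in _ < X]cP cardE index_mem mem_enum.
pose c : {ffun 'I_n -> 'I_k} := [ffun x => Ordinal (ltk x)].
have fibE B : B \in P -> exists p, fib c p = B.
  move=> BP; have hp : index B (enum P) < k by rewrite -[X in _ < X]cP cardE index_mem mem_enum.
  exists (Ordinal hp); apply/setP=> x; rewrite inE ffunE -(inj_eq val_inj) /=.
  apply/eqP/idP => [e|xB]; last by rewrite (def_pblock tI BP xB).
  have : pblock P x = B.
    by rewrite -(nth_index set0 (_ : pblock P x \in enum P)) ?mem_enum // e nth_index ?mem_enum.
  by move=> <-; rewrite mem_pblock cov.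
have Bfib p : fib c p \in P.
  have pk : p < size (enum P) by rewrite -cardE cP.
  pose B := nth set0 (enum P) p.
  have BP : B \in P by rewrite -mem_enum mem_nth.
  suff -> : fib c p = B by [].
  have [q eq] := fibE B BP; rewrite -eq; congr fib; apply: val_inj.
  have [x xB] : exists x, x \in B.
    by apply/set0Pn; apply: contraNneq P0 => <-.
  have := xB; rewrite -eq inE ffunE => /eqP <- /=.
  by rewrite (def_pblock tI BP xB) /B index_uniq ?enum_uniq.
exists c => [p|]; first by apply/eqP/szP.
apply/setP=> B; apply/idP/imsetP => [BP|[p _ ->]//].
by have [p <-] := fibE B BP; exists p.
Qed.

Lemma pact1 (P : Part) : pact P 1%g = P.
Proof.
rewrite /pact -[RHS]imset_id; apply: eq_imset => B.
by rewrite -[RHS]imset_id; apply: eq_imset => x; rewrite perm1.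
Qed.

Lemma pactM (P : Part) g h : pact P (g * h)%g = pact (pact P g) h.
Proof.
rewrite /pact -imset_comp; apply: eq_imset => B /=.
by rewrite -imset_comp; apply: eq_imset => x /=; rewrite permM.
Qed.

Definition pact_action := TotalAction pact1 pactM.

(** Orbit-stabiliser turns a largest orbit into a smallest intersection with [fixg]. *)
Lemma orb_card (H : {group {perm 'I_n}}) (c : 'I_n -> 'I_k) : balanced l c ->
  #|orb (@pact n) H (parts c)| * #|H :&: fixg c| = #|H|.
Proof.
move=> cb; rewrite -(card_orbit_stab pact_action H (parts c)); congr (_ * _).
apply: eq_card => g; rewrite in_setI [in RHS]in_setI; congr (_ && _).
by rewrite -parts_fixP //; apply/eqP/astab1P.
Qed.

Variables (G : {group {perm 'I_n}}) (eps : nat).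
Hypothesis eps_ge : forall (F : finType) (f : 'I_n -> F), #|kerg f| <= eps * #|G :&: kerg f|.
Hypothesis eps_le : forall (F : finType) (f : 'I_n -> F), eps * #|G :&: kerg f| <= maxn 2 #|kerg f|.
Hypothesis eps2 : eps <= 2.
Hypothesis n4 : 4 < n.

(** A chosen colouring of each partition; the constant default occurs only outside [Pi k l]. *)
Definition coltab (P : Part) : {ffun 'I_n -> 'I_k} :=
  odflt [ffun=> Ordinal k0] [pick c : {ffun 'I_n -> 'I_k} | [forall p, #|fib c p| == l] && (P == parts c)].

Lemma coltabP P : P \in Pi k l -> balanced l (coltab P) /\ P = parts (coltab P).
Proof.
move=> /Pi_parts[c cb cP]; rewrite /coltab; case: pickP => [c' /andP[/forallP h /eqP e]|/(_ c)].
  by split=> // p; apply/eqP.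
by rewrite cP eqxx andbT (introT forallP) // => p; rewrite cb.
Qed.

(** The joint colouring [f] has a kernel of order at most 2, so at most one pair is not separated
    and n <= k^|B| + 1. Equality fails because [k] divides [n]. *)
Lemma base_card B tau : (forall t, n <= k ^ t -> tau <= t) ->
  is_base (@pact n) G (Pi k l) B -> tau <= #|B|.
Proof.
move=> mint /andP[/subsetP BO triv].
pose f x : {ffun 'I_#|B| -> 'I_k} := [ffun j => coltab (enum_val j) x].
have K1 : #|G :&: kerg f| <= 1.
  rewrite -(cards1 (1%g : {perm 'I_n})); apply: subset_leq_card; apply: subset_trans triv.
  apply/subsetP=> g; rewrite inE => /andP[gG /kergP gf]; rewrite inE gG; apply/forall_inP=> P PB.
  have [cb eP] := coltabP (BO P PB).
  rewrite {1 2}eP parts_fixP //; apply: (subsetP (kerg_sub_fixg _)); apply/kergP=> x.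
  have /ffunP/(_ (enum_rank_in PB P)) := gf x.
  by rewrite !ffunE enum_rankK_in.
have K2 : #|kerg f| <= 2.
  by apply: leq_trans (eps_ge f) _; rewrite -[2]muln1 leq_mul.
have S1 : \sum_z #|fib f z|.-1 <= 1.
  rewrite -(@leq_exp2l 2) // expn1; apply: leq_trans K2; rewrite card_kerg expn_sum.
  apply: leq_prod => z _; elim: #|_| => [|[|a] IH] //=; rewrite factS expnS leq_mul //.
have nle : n <= k ^ #|B| + 1.
  rewrite -{1}(sum_fib f); apply: leq_trans (_ : \sum_z (1 + #|fib f z|.-1) <= _).
    by apply: leq_sum => z _; lia.
  by rewrite big_split /= sum1_card card_ffun !card_ord leq_add2l.
apply: mint; move: nle; rewrite addn1 leq_eqVlt => /orP[/eqP e|//].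
case: (posnP #|B|) => b0; first by move: e n4; rewrite b0 expn0; lia.
exfalso; have : k %| 1.
  rewrite -(@dvdn_addr (k ^ #|B|)); first by rewrite addn1 -e dvdn_mulr.
  by rewrite -(prednK b0) expnS dvdn_mulr.
by rewrite dvdn1; move: k1; lia.
Qed.

Lemma greedy_le s : greedy_base (@pact n) G (Pi k l) s ->
  size s <= 11 * base_size (@pact n) G (Pi k l).
Proof.
move=> [gr triv].
have ex : exists t, n <= k ^ t by exists n; apply: ltnW; apply: ltn_expl.
case: (ex_minnP ex) => tau tau2 mint.
have sO P : P \in s -> P \in Pi k l.
  by move=> Ps; case/splitPr: Ps gr => p q /(_ p q P erefl)[].
have tb : tau <= base_size (@pact n) G (Pi k l).
  have bs : is_base (@pact n) G (Pi k l) [set y in s].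
    by rewrite /is_base triv andbT; apply/subsetP=> P; rewrite inE => /sO.
  rewrite /base_size; apply: (big_ind (fun m => tau <= m)).
  (* The default value in [base_size]: [Pi k l] contains the base formed by [s], so its size is at
     least [tau] as well. *)
  - apply: leq_trans (base_card mint bs) _; apply: subset_leq_card.
    by case/andP: bs.
  - by move=> a b ha hb; rewrite leq_min ha hb.
  - by move=> B; apply: base_card.
apply: leq_trans (_ : 11 * tau <= _); last by rewrite leq_mul2l tb.
rewrite leqNgt; apply/negP=> tauN.
pose c i : 'I_n -> 'I_k := coltab (nth set0 s i).
have stabE i : i <= size s -> stab G c i = pstab (@pact n) G [set y in take i s] :> {set _}.
  elim: i => [|i IH] is_.
    by apply/setP=> g; rewrite take0 inE; case: (g \in G) => //=; apply/esym/forall_inP=> P; rewrite inE.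
  rewrite /= IH 1?ltnW //; apply/setP=> g; rewrite in_setI (take_nth set0) //.
  rewrite [in RHS]inE [in X in X && _ = _]inE -andbA; congr (_ && _).
  have [cb eP] := coltabP (sO _ (mem_nth set0 is_)).
  rewrite -parts_fixP // -eP; apply/andP/forall_inP => [[/forall_inP h1 h2] P|h].
    by rewrite inE mem_rcons inE => /orP[/eqP -> //|Pt]; apply: h1; rewrite inE.
  split; last by apply: h; rewrite inE mem_rcons mem_head.
  by apply/forall_inP=> P; rewrite inE => Pt; apply: h; rewrite inE mem_rcons inE Pt orbT.
have split_s i : i < size s -> s = take i s ++ nth set0 s i :: drop i.+1 s.
  by move=> is_; rewrite -drop_nth // cat_take_drop.
apply: (@run_absurd n k l erefl k1 l1 G eps eps_ge eps_le eps2 (size s) c _ _ _ tau) => //.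
- by move=> i is_; have [cb _] := coltabP (sO _ (mem_nth set0 is_)).
- move=> i c' is_ cb'; have [cb eP] := coltabP (sO _ (mem_nth set0 is_)).
  have [_ _ /(_ _ (parts_Pi cb'))] := gr _ _ _ (split_s i is_); rewrite -(stabE i (ltnW is_)).
  rewrite {1}eP => h.
  have e1 := orb_card (stab G c i) cb; have e2 := orb_card (stab G c i) cb'.
  have p2 : 0 < #|orb (@pact n) (stab G c i) (parts c')|.
    by move: (cardG_gt0 (stab G c i)); rewrite -e2 muln_gt0 => /andP[].
  rewrite -(leq_pmul2l p2) e2 -e1 /=; rewrite leq_mul2r h orbT //.
- move=> i is_; have [nt _ _] := gr _ _ _ (split_s i is_); rewrite ltnNge; apply: contra nt => le.
  rewrite -(stabE i (ltnW is_)); have := card_le1_trivg le => ->.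
  exact: subxx.
have tau0 : 0 < tau by case: tau tau2 {mint tb tauN} => //; rewrite expn0; move: n4; lia.
rewrite ltnNge; apply/negP=> /mint; by move: tau0; lia.
Qed.
End Bridge.

Theorem theorem3p18 (k l : nat) (hk : 2 <= k) (hl : 2 <= l) (hkl : 4 < k * l)
  (G : {set {perm 'I_(k * l)}})
  (hG : G = ('Sym_('I_(k * l)))%g \/ G = ('Alt_('I_(k * l)))%g)
  (s : seq {set {set 'I_(k * l)}}) :
  greedy_base (@pact (k * l)) G (Pi k l) s ->
  size s <= 11 * base_size (@pact (k * l)) G (Pi k l).
Proof.
case: hG => ->.
  apply: (@greedy_le k l hk hl ('Sym_('I_(k * l)))%G 1) => // F f; rewrite setTI mul1n //.
  exact: leq_maxr.
by apply: (@greedy_le k l hk hl ('Alt_('I_(k * l)))%G 2) => // F f; case: (kerg_Alt f).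
Qed.
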